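(* Consider the linear model $Y=X\beta^*+\xi$ for a given design matrix $X\in\mathbb{R}^{n\times p}$, $p=md$, where $Y\in\mathbb{R}^n$ and $\xi\in\mathbb{R}^n$ is a sub-Gaussian random vector with parameter $\sigma^2$. Suppose $m\ge4s\ge c_1$ and $d\ge4s_0\ge c_2$ for constants $c_1,c_2>0$. Assume that there exist positive constants $\tau_u<\infty$ and $\tau_\ell>0$ such that $$\frac{1}{\sqrt n}\|X\beta\|_2\le\tau_u\|\beta\|_2\quad\text{and}\quad \frac{1}{\sqrt n}\|X\beta\|_2\ge\tau_\ell\|\beta\|_2\qquad\text{for all }\beta\in\mathcal B^{m,d}_0(2s,2s_0).$$ Then the minimax rate scales as $$\inf_{\hat \beta} \sup_{\beta^* \in \mathcal{B}^{m,d}_0(s, s_0)}E\left[\|\hat \beta - \beta^*\|_2^2\right] \asymp \frac{\sigma^2}{n}\Big( s \log \frac{em}{s}+ss_0\log \frac{ed}{s_0}\Big),$$ where the infimum is over all estimators $\hat\beta$.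
   Context: The index set $\{1,\dots,p\}$ is partitioned into $m$ predefined non-overlapping groups $G_1,\dots,G_m$ with $|G_j|=d$; $\beta_{G_j}\in\mathbb{R}^d$ is the corresponding subvector of $\beta\in\mathbb{R}^p$. For positive integers $a,b$, $\mathcal B_0^{m,d}(a,b)$ is the set of $(a,b)$-double sparse vectors, i.e. of $\beta\in\mathbb{R}^p$ such that $\sum_{j=1}^m\mathbb I(\|\beta_{G_j}\|_2\ne0)\le a$ and each $\beta_{G_j}$ has at most $b$ nonzero entries. The notation $A\asymp B$ means $cB\le A\le CB$ for some positive constants $c,C$. *)

(* Defs.v *)
From HB Require Import structures.
From mathcomp Require Import all_boot all_order all_algebra.
From mathcomp Require Import all_classical all_reals all_analysis.
Set Implicit Arguments.
Unset Strict Implicit.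
Unset Printing Implicit Defensive.
Import Order.TTheory GRing.Theory Num.Theory.
Local Open Scope ring_scope.

(* Tuples carry the product Borel sigma-algebra in the library, column vectors
   carry the linear algebra; [tcol] identifies the two copies of R^n. *)
Definition tcol (R : realType) (n : nat) (t : n.-tuple R) : 'cV[R]_n :=
  \col_(i < n) tnth t i.

(* Euclidean norm (the norm that the library puts on matrices is the sup norm). *)
Definition l2norm (R : realType) (n : nat) (v : 'cV[R]_n) : R :=
  Num.sqrt (\sum_(i < n) v i ord0 ^+ 2).

Definition group_l2norm (R : realType) (p : nat) (b : 'cV[R]_p)
    (A : {set 'I_p}) : R :=
  Num.sqrt (\sum_(i in A) b i ord0 ^+ 2).

Definition grouping (p m d : nat) (G : 'I_m -> {set 'I_p}) : Prop :=
  [/\ (\bigcup_(j < m) G j)%SET = [set: 'I_p]%SET,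
      forall j k : 'I_m, j != k -> [disjoint G j & G k]
    & forall j : 'I_m, #|G j| = d].

Local Open Scope classical_set_scope.

Definition double_sparse (R : realType) (p m : nat) (G : 'I_m -> {set 'I_p})
    (a b : nat) : set 'cV[R]_p :=
  [set beta |
    (\sum_(j < m) (group_l2norm beta (G j) != 0%R) <= a)%N /\
    forall j : 'I_m, (#|[set i in G j | beta i ord0 != 0%R]%SET| <= b)%N].

(* xi is sub-Gaussian with parameter sigma ^+ 2; centering and finiteness of all
   moments follow from the bound holding for every direction u. *)
Definition sub_gaussian (d : measure_display) (T : measurableType d)
    (R : realType) (P : probability T R) (n : nat)
    (xi : {RV P >-> n.-tuple R}) (sigma : R) : Prop :=
  forall u : 'cV[R]_n,
    ('E_P[fun w => expR (\sum_(i < n) u i ord0 * tnth (xi w) i)]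
      <= (expR (sigma ^+ 2 * l2norm u ^+ 2 / 2))%:E)%E.

Definition response (R : realType) (n p : nat) (X : 'M[R]_(n, p))
    (beta : 'cV[R]_p) (e : n.-tuple R) : n.-tuple R :=
  [tuple (X *m beta) i ord0 + tnth e i | i < n].

Definition risk (d : measure_display) (T : measurableType d) (R : realType)
    (P : probability T R) (n p : nat) (X : 'M[R]_(n, p))
    (xi : {RV P >-> n.-tuple R}) (betahat : n.-tuple R -> p.-tuple R)
    (beta : 'cV[R]_p) : \bar R :=
  'E_P[fun w => l2norm (tcol (betahat (response X beta (xi w))) - beta) ^+ 2].

(* The noise law is only known to be sub-Gaussian with parameter sigma ^+ 2, so
   the worst case ranges over all such noise vectors together with the
   parameter.  (For one fixed law, such as xi = 0, the risk can be 0.) *)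
Definition worst_case_risk (R : realType) (n p m : nat) (X : 'M[R]_(n, p))
    (G : 'I_m -> {set 'I_p}) (s s0 : nat) (sigma : R)
    (betahat : n.-tuple R -> p.-tuple R) : \bar R :=
  ereal_sup [set r | exists (beta : 'cV[R]_p)
      (d : measure_display) (T : measurableType d) (P : probability T R)
      (xi : {RV P >-> n.-tuple R}),
    [/\ double_sparse G s s0 beta, sub_gaussian xi sigma
      & r = risk X xi betahat beta]].

(* The estimators are the measurable functions of the response; they may depend
   on X, G, s, s0 and sigma. *)
Definition minimax_risk (R : realType) (n p m : nat) (X : 'M[R]_(n, p))
    (G : 'I_m -> {set 'I_p}) (s s0 : nat) (sigma : R) : \bar R :=
  ereal_inf [set r | exists betahat : {mfun n.-tuple R >-> p.-tuple R},
    r = worst_case_risk X G s s0 sigma betahat].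

Definition minimax_rate (R : realType) (n m d s s0 : nat) (sigma : R) : R :=
  sigma ^+ 2 / n%:R *
    (s%:R * ln (expR 1 * m%:R / s%:R)
     + s%:R * s0%:R * ln (expR 1 * d%:R / s0%:R)).

(* Main.v *)
From HB Require Import structures.
Require Import Defs.
From mathcomp Require Import all_boot all_order all_algebra.
From mathcomp Require Import all_classical all_reals all_analysis.
From mathcomp Require Import measurable_realfun.
From mathcomp Require Import ring lra zify.
Import Order.TTheory GRing.Theory Num.Theory.
Local Open Scope classical_set_scope.
Local Open Scope ring_scope.
Set Implicit Arguments.
Unset Strict Implicit.
Unset Printing Implicit Defensive.

(* Lower bound. The noise law may depend on beta, so Gaussian noise can be replaced by a
   discrete one: each coordinate of Y is a rescaled sum of N^2 independent biased signs
   with mean (X beta)_i, which is sub-Gaussian since e^y <= y + e^(2y^2). Put in each of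
   many disjoint blocks of k coordinates one nonzero entry of size a, at a uniform place.
   Given the other blocks, the likelihood ratio of each of the k laws of Y to the law
   where the block is empty has second moment at most e^(c n a^2 / sigma^2) <= k / 2, so
   the place is misidentified with probability bounded below, at a cost a^2 / 2. Summing
   over blocks, one group per block (s blocks of m / s groups) and one coordinate per
   block (s s0 blocks of d / s0 coordinates) give the two terms of the rate.

   Upper bound. A near minimizer of the residual over a countable dense set of
   double-sparse vectors is a measurable function of Y, and its error Delta satisfies
   |Delta|^2 <= C (|(X^T xi)_S|^2 + sigma^2 n) / n^2 with S the support of Delta. The
   exponential moment of c |(X^T xi)_S|^2 / (n sigma^2) is at most K^|S|, and the logarithm
   of the number of supports S is at most a multiple of n / sigma^2 times the rate. *)

(** * Elementary inequalities *)

(** Averaged over a centred [y], the linear term vanishes and a sub-Gaussian bound remains. For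
    [y > 1/2], [y <= 2 y^2]; otherwise [e^y <= 1 / (1 - y) <= 1 + y + 2 y^2]. *)
Lemma expR_le_id_sqr (R : realType) (y : R) : expR y <= y + expR (2 * y ^+ 2).
Proof.
have [y2|y2] := leP y 2^-1; last first.
  have : expR y <= expR (2 * y ^+ 2).
    rewrite ler_expR; nra.
  lra.
have h1 : expR y * (1 - y) <= 1.
  rewrite -[leRHS](expRxMexpNx_1 y) ler_wpM2l ?expR_ge0//.
  exact: expR_ge1Dx.
have h2 := expR_ge1Dx (2 * y ^+ 2).
suff : expR y <= 1 + y + 2 * y ^+ 2 by lra.
rewrite -(@ler_pM2r _ (1 - y)); last by lra.
apply: (le_trans h1); nra.
Qed.

Lemma expR1_le4 (R : realType) : expR 1 <= 4 :> R.
Proof.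
have h : expR 2^-1 <= 2 :> R.
  have := expR_ge1Dx (- 2^-1 : R); rewrite expRN => h1.
  have h0 := expR_gt0 (2^-1 : R).
  rewrite -[leLHS]invrK invf_ple ?posrE ?invr_gt0//; lra.
have -> : (1 : R) = 2^-1 + 2^-1 by lra.
rewrite expRD; have := expR_ge0 (2^-1 : R); nra.
Qed.

Lemma ler_sum_inj (R : realType) (I J : finType) (A : pred I) (h : I -> J) (F : J -> R) :
  injective h -> (forall j, 0 <= F j) -> \sum_(i | A i) F (h i) <= \sum_j F j.
Proof.
move=> hI F0; rewrite -(big_imset F (in2W hI))/=.
rewrite [leRHS](bigID (mem [set h i | i in A]%SET))/= lerDl.
by apply: sumr_ge0 => j _; exact: F0.
Qed.

(** The law is a sum of weighted Dirac masses on codes in [nat], where every set is measurable, so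
    functions of the outcome raise no measurability question. The default [w0] is returned only at
    codes of mass zero. *)
Lemma finite_probability (R : realType) (W : finType) (w0 : W) (q : W -> R) :
  (forall w, 0 <= q w) -> \sum_w q w = 1 ->
  exists P : probability nat R, forall F : W -> R, (forall w, 0 <= F w) ->
    ('E_P[fun i => F (nth w0 (enum W) i)] = (\sum_w q w * F w)%:E)%E.
Proof.
move=> q0 q1; set dec := nth w0 (enum W).
pose m_ (i : nat) : {measure set nat -> \bar R} := mscale (NngNum (q0 (dec i))) \d_i.
have sumE (F : W -> R) : \sum_(i < #|W|) F (dec i) = \sum_w F w.
  by rewrite -(big_mkord xpredT (fun i => F (dec i))) [RHS]big_enum_val
     big_mkord; apply: eq_bigr => i _; rewrite (enum_val_nth w0).
have mT : msum m_ #|W| setT = 1%E.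
  rewrite /msum (eq_bigr (fun i : 'I_#|W| => (q (dec i))%:E)) => [|i _].
    by rewrite sumEFin sumE q1.
  by rewrite /m_ /= /mscale /= /dirac indicT mule1.
pose P : probability nat R := HB.pack_for (probability nat R)
  (msum m_ #|W|) (Measure_isProbability.Build _ _ _ (msum m_ #|W|) mT).
exists P => F F0; rewrite expectation.unlock.
transitivity (\int[msum m_ #|W|]_i (F (dec i))%:E)%E; first by [].
rewrite ge0_integral_measure_sum//; last by move=> x _; rewrite lee_fin.
rewrite -sumE -sumEFin; apply: eq_bigr => i _.
rewrite ge0_integral_mscale//; last by move=> x _; rewrite lee_fin.
by rewrite integral_dirac// /dirac indicT mul1e.
Qed.

(** * Products of biased signs *)

Section coin_product.
Context (R : realType).

Definition coin_sign (b : bool) : R := if b then 1 else -1.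

(** The law of a sign with mean [x]. *)
Definition coin (x : R) (b : bool) : R := (1 + coin_sign b * x) / 2.

Lemma coin_ge0 x b : `|x| <= 2^-1 -> 0 <= coin x b.
Proof. by rewrite ler_norml /coin /coin_sign; case: b => /andP[? ?]; lra. Qed.

Lemma coin_gt0 x b : `|x| <= 2^-1 -> 0 < coin x b.
Proof. by rewrite ler_norml /coin /coin_sign; case: b => /andP[? ?]; lra. Qed.

Context (J : finType).
Implicit Types (x y : J -> R) (w : {ffun J -> bool}).

Definition coins x w : R := \prod_j coin (x j) (w j).

Lemma coins_ge0 x w : (forall j, `|x j| <= 2^-1) -> 0 <= coins x w.
Proof. by move=> hx; apply: prodr_ge0 => j _; exact: coin_ge0. Qed.

Lemma coins_prod x (F : J -> bool -> R) :
  \sum_w coins x w * \prod_j F j (w j) =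
  \prod_j (coin (x j) true * F j true + coin (x j) false * F j false).
Proof.
under [RHS]eq_bigr => j _ do rewrite -(big_bool _ (fun b => coin (x j) b * F j b)).
by rewrite bigA_distr_bigA/=; apply: eq_bigr => w _; rewrite -big_split.
Qed.

Lemma coins_sum1 x : \sum_w coins x w = 1.
Proof.
transitivity (\sum_w coins x w * \prod_(j : J) (fun _ _ => 1 : R) j (w j)).
  by apply: eq_bigr => w _; rewrite big1// mulr1.
rewrite (coins_prod x (fun _ _ => 1)) big1// => j _.
rewrite /coin /coin_sign; lra.
Qed.

(** By independence the sum factors. In each factor [expR_le_id_sqr] is applied to [u (sign - x)],
    which has mean zero and square at most [4 u^2]. *)
Lemma coins_mgf x (u : J -> R) : (forall j, `|x j| <= 2^-1) ->
  \sum_w coins x w * expR (\sum_j u j * (coin_sign (w j) - x j)) <=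
  expR (8 * \sum_j u j ^+ 2).
Proof.
move=> hx; under eq_bigr do rewrite expR_sum.
rewrite (coins_prod x (fun j b => expR (u j * (coin_sign b - x j)))).
rewrite mulr_sumr expR_sum; apply: ler_prod => j _; apply/andP; split.
  by rewrite addr_ge0// mulr_ge0 ?expR_ge0 ?coin_ge0.
have key b : expR (u j * (coin_sign b - x j)) <=
    u j * (coin_sign b - x j) + expR (8 * u j ^+ 2).
  apply: (le_trans (expR_le_id_sqr _)); rewrite lerD2l ler_expR.
  have : (coin_sign b - x j) ^+ 2 <= 4.
    have := hx j; rewrite ler_norml /coin_sign => /andP[? ?].
    by case: b; nra.
  rewrite exprMn; have := sqr_ge0 (u j); nra.
have e1 : coin (x j) true + coin (x j) false = 1.
  rewrite /coin /coin_sign; lra.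
have e2 : coin (x j) true * (u j * (coin_sign true - x j)) +
  coin (x j) false * (u j * (coin_sign false - x j)) = 0.
  by rewrite /coin /coin_sign; field.
have h1 := ler_wpM2l (coin_ge0 true (hx j)) (key true).
have h2 := ler_wpM2l (coin_ge0 false (hx j)) (key false).
apply: (le_trans (lerD h1 h2)); rewrite (mulrDr (coin _ true)) (mulrDr (coin _ false)).
rewrite addrACA e2 add0r -mulrDl e1.
by rewrite mul1r.
Qed.

(** Each coordinate contributes exactly [1 + (x - y)^2 / (1 - y^2)], and [|y| <= 1/2] gives
    [1 / (1 - y^2) <= 2]. *)
Lemma coins_chi2 x y : (forall j, `|y j| <= 2^-1) ->
  \sum_w coins y w * (\prod_j (coin (x j) (w j) / coin (y j) (w j))) ^+ 2 <=
  expR (2 * \sum_j (x j - y j) ^+ 2).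
Proof.
move=> hy; under eq_bigr do rewrite -prodrXl.
rewrite (coins_prod y (fun j b => (coin (x j) b / coin (y j) b) ^+ 2)).
rewrite mulr_sumr expR_sum; apply: ler_prod => j _.
have t0 := coin_gt0 true (hy j); have f0 := coin_gt0 false (hy j).
apply/andP; split.
  by rewrite addr_ge0// mulr_ge0 ?sqr_ge0// ltW.
apply: le_trans (expR_ge1Dx _).
have hy2 : 0 < 1 - y j ^+ 2 by have := hy j; rewrite ler_norml => /andP[? ?]; nra.
have -> : coin (y j) true * (coin (x j) true / coin (y j) true) ^+ 2 +
   coin (y j) false * (coin (x j) false / coin (y j) false) ^+ 2 =
   1 + (x j - y j) ^+ 2 / (1 - y j ^+ 2).
  have : 1 + y j != 0 by have := hy j; rewrite ler_norml => /andP[? ?]; apply/eqP; lra.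
  have : 1 - y j != 0 by have := hy j; rewrite ler_norml => /andP[? ?]; apply/eqP; lra.
  rewrite /coin /coin_sign => h1 h2; field; rewrite ?h1 ?h2 ?(gt_eqF hy2)//=.
  by rewrite -[- y j]mulN1r in h1 *; rewrite mulN1r addrC in h1 *; rewrite ?h1 ?h2 /=.
rewrite lerD2l ler_pdivrMr//.
have hy3 : 1 <= 2 * (1 - y j ^+ 2).
  by have := hy j; rewrite ler_norml => /andP[? ?]; nra.
by rewrite mulrAC ler_peMl ?sqr_ge0.
Qed.

(** Change of measure: the likelihood ratio satisfies [L <= t L^2 / 2 + 1 / (2 t)] by AM-GM, with
    [t] left free for balancing. *)
Lemma coins_change x y (A : pred {ffun J -> bool}) (t : R) : 0 < t ->
  (forall j, `|y j| <= 2^-1) ->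
  \sum_(w | A w) coins x w <=
  t / 2 * (\sum_(w | A w) coins y w *
      (\prod_j (coin (x j) (w j) / coin (y j) (w j))) ^+ 2)
  + (2 * t)^-1 * \sum_(w | A w) coins y w.
Proof.
move=> t0 hy; rewrite !mulr_sumr -big_split/=; apply: ler_sum => w _.
have -> : coins x w = coins y w * \prod_j (coin (x j) (w j) / coin (y j) (w j)).
  rewrite /coins -big_split/=; apply: eq_bigr => j _.
  by rewrite mulrCA divff ?mulr1// gt_eqF// coin_gt0.
set L := \prod_j _; have q0 := coins_ge0 w hy.
have : L <= t / 2 * L ^+ 2 + (2 * t)^-1.
  rewrite -subr_ge0.
  have -> : t / 2 * L ^+ 2 + (2 * t)^-1 - L = (t * L - 1) ^+ 2 / (2 * t).
    by field; rewrite gt_eqF.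
  by rewrite divr_ge0 ?sqr_ge0// mulr_ge0// ltW.
nra.
Qed.

Lemma coins_test_error (k : nat) (x : 'I_k -> J -> R) y
    (guess : {ffun J -> bool} -> 'I_k) : (4 <= k)%N ->
  (forall j, `|y j| <= 2^-1) -> (forall i j, `|x i j| <= 2^-1) ->
  (forall i, expR (2 * \sum_j (x i j - y j) ^+ 2) <= k%:R / 2) ->
  7 / 24 * k%:R <= \sum_i \sum_(w | guess w != i) coins (x i) w.
Proof.
move=> k4 hy hx he.
have k4R : 4 <= k%:R :> R by rewrite (ler_nat _ 4 k).
suff : \sum_i \sum_(w | guess w == i) coins (x i) w <= 17 / 24 * k%:R.
  have : \sum_i \sum_(w | guess w == i) coins (x i) w +
         \sum_i \sum_(w | guess w != i) coins (x i) w = k%:R.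
    rewrite -big_split/= -[in RHS](card_ord k) -sum1_card natr_sum.
    apply: eq_bigr => i _; rewrite -(coins_sum1 (x i)).
    by rewrite [RHS](bigID (fun w => guess w == i)).
  lra.
(* The two terms [t k^2 / 4] and [1 / (2 t)] balance at [t = sqrt 2 / k]; the nearby rational
   [3 / (2 k)] gives [3/8 + 1/3 = 17/24] of [k]. *)
pose t : R := 3 / (2 * k%:R).
have t0 : 0 < t by rewrite divr_gt0// mulr_gt0//; lra.
apply: (@le_trans _ _ (\sum_(i < k) (t / 2 * (k%:R / 2) +
    (2 * t)^-1 * \sum_(w | guess w == i) coins y w))).
  apply: ler_sum => i _; apply: (le_trans (coins_change _ _ t0 hy)).
  rewrite lerD2r ler_wpM2l//; first by rewrite divr_ge0// ltW.
  apply: le_trans (he i); apply: le_trans (coins_chi2 _ hy).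
  rewrite [leRHS](bigID (fun w => guess w == i))/= lerDl.
  by apply: sumr_ge0 => w _; rewrite mulr_ge0 ?sqr_ge0// coins_ge0.
rewrite big_split/= -[X in _ + X <= _]mulr_sumr.
(* The events [guess w == i] partition the outcomes, so a single unit of reference mass serves all
   [k] hypotheses. *)
have -> : \sum_(i < k) \sum_(w | guess w == i) coins y w = 1.
  by rewrite -(coins_sum1 y) [RHS](partition_big guess xpredT).
rewrite sumr_const card_ord -[X in X + _ <= _]mulr_natl mulr1 /t.
have -> : k%:R * (3 / (2 * k%:R) / 2 * (k%:R / 2)) + (2 * (3 / (2 * k%:R)))^-1
   = 17 / 24 * k%:R :> R; last by [].
by field; rewrite gt_eqF//; lra.
Qed.

End coin_product.

(** * Simultaneous testing in many blocks *)

Section blocks.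
Context (R : realType) (J B : finType) (k : nat).

Definition upd (f : {ffun B -> 'I_k}) (b : B) (l : 'I_k) : {ffun B -> 'I_k} :=
  [ffun b' => if b' == b then l else f b'].

(** Resampling one coordinate of a uniform placement leaves it uniform: exchanging [f b] with a
    spare label is an involution of the pairs [(f, l)]. *)
Lemma sum_upd (b : B) (g : {ffun B -> 'I_k} -> R) :
  k%:R * \sum_f g f = \sum_f \sum_l g (upd f b l).
Proof.
pose swap (z : {ffun B -> 'I_k} * 'I_k) := (upd z.1 b z.2, z.1 b).
have swapK : involutive swap.
  move=> [f l]; rewrite /swap /=; congr pair; last by rewrite ffunE eqxx.
  by apply/ffunP => b'; rewrite !ffunE; case: eqP => [->|].
rewrite pair_big/= -(pair_big xpredT xpredT (fun f l => g (upd f b l)))/=.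
rewrite (pair_big xpredT xpredT (fun f l => g (upd f b l)))/=.
rewrite (reindex_inj (inv_inj swapK))/=.
transitivity (\sum_(z : {ffun B -> 'I_k} * 'I_k) g z.1).
  rewrite -(pair_big xpredT xpredT (fun f l => g f))/=.
  rewrite mulr_sumr; apply: eq_bigr => f _.
  by rewrite sumr_const card_ord mulr_natl.
apply: eq_bigr => z _; congr g.
by have /(congr1 fst) := swapK z.
Qed.

Lemma coins_blocks_error (v : B -> 'I_k -> J -> R)
    (guess : B -> {ffun J -> bool} -> 'I_k) : (4 <= k)%N ->
  (forall (f : {ffun B -> 'I_k}) (A : pred B) j,
     `|\sum_(b | A b) v b (f b) j| <= 2^-1) ->
  (forall b l, expR (2 * \sum_j v b l j ^+ 2) <= k%:R / 2) ->
  7 / 24 * #|B|%:R * #|{ffun B -> 'I_k}|%:R <=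
  \sum_(f : {ffun B -> 'I_k}) \sum_b \sum_(w | guess b w != f b) coins (fun j => \sum_b v b (f b) j) w.
Proof.
move=> k4 hv he; have k0 : 0 < k%:R :> R by rewrite ltr0n (leq_trans _ k4).
rewrite exchange_big/= mulrAC -mulr_natr -[#|B|]sum1_card natr_sum mulr_sumr.
apply: ler_sum => b _; rewrite mul1r mulr1.
pose g (f : {ffun B -> 'I_k}) :=
  \sum_(w | guess b w != f b) coins (fun j => \sum_b v b (f b) j) w.
change (7 / 24 * #|{ffun B -> 'I_k}|%:R <= \sum_f g f).
rewrite -(ler_pM2l k0) (sum_upd b g).
have -> : k%:R * (7 / 24 * #|{ffun B -> 'I_k}|%:R) =
    \sum_(f : {ffun B -> 'I_k}) (7 / 24 * k%:R) :> R.
  by rewrite sumr_const -[RHS]mulr_natr mulrCA mulrA.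
apply: ler_sum => f _.
(* The reference law has block [b] emptied; [hv] for arbitrary sets of blocks keeps its means within
   1/2 as well. *)
pose y j := \sum_(b' | b' != b) v b' (f b') j.
pose x l j := y j + v b l j.
have xE l : (fun j => \sum_b' v b' (upd f b l b') j) = x l.
  apply/funext => j; rewrite (bigD1 b)//= ffunE eqxx addrC; congr +%R.
  by apply: eq_bigr => b' /negPf bb'; rewrite ffunE bb'.
have -> : \sum_l g (upd f b l) = \sum_l \sum_(w | guess b w != l) coins (x l) w.
  by apply: eq_bigr => l _; rewrite /g xE ffunE eqxx.
apply: (coins_test_error (y := y)) => // [j|l j|l]; first exact: hv.
  by rewrite -xE; exact: (hv _ xpredT).
rewrite (eq_bigr (fun j => v b l j ^+ 2)) => [|j _]; first exact: he.
by rewrite /x addrC addKr.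
Qed.

End blocks.

(** * Sign noise and blockwise priors *)

Section noise.
Context (R : realType).

Lemma l2norm_sqr n (v : 'cV[R]_n) : l2norm v ^+ 2 = \sum_i v i ord0 ^+ 2.
Proof. by rewrite sqr_sqrtr// sumr_ge0// => i _; exact: sqr_ge0. Qed.

(* Averaging N^2 signs for each coordinate keeps their means in [-1/2, 1/2] for N large. *)
Lemma coin_noise (n N : nat) (sg : R) (x : 'I_n * 'I_(N ^ 2) -> R) :
  (0 < N)%N -> (forall j, `|x j| <= 2^-1) ->
  exists (P : probability nat R) (xi : {RV P >-> n.-tuple R})
    (dec : nat -> {ffun 'I_n * 'I_(N ^ 2) -> bool}),
  [/\ sub_gaussian xi (4 * sg),
      forall t i, tnth (xi t) i =
        sg / N%:R * \sum_k (coin_sign R (dec t (i, k)) - x (i, k))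
    & forall F, (forall w, 0 <= F w) ->
      ('E_P[fun t => F (dec t)] = (\sum_w coins x w * F w)%:E)%E].
Proof.
move=> N0 hx.
have w0 : {ffun 'I_n * 'I_(N ^ 2) -> bool} by exact: [ffun=> true].
have [P PE] := finite_probability w0 (fun w => coins_ge0 w hx) (coins_sum1 x).
pose dec := nth w0 (enum {ffun 'I_n * 'I_(N ^ 2) -> bool}).
pose f (t : nat) : n.-tuple R := [tuple sg / N%:R *
  \sum_(k < N ^ 2) (coin_sign R (dec t (i, k)) - x (i, k)) | i < n].
have mf : measurable_fun setT f by [].
pose xi : {RV P >-> n.-tuple R} := HB.pack_for {mfun nat >-> n.-tuple R} f
  (isMeasurableFun.Build _ _ _ _ f mf).
exists P, xi, dec; split=> // [u|t i]; last by rewrite /xi/= tnth_mktuple.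
pose lam (j : 'I_n * 'I_(N ^ 2)) := u j.1 ord0 * (sg / N%:R).
have := PE (fun w => expR (\sum_j lam j * (coin_sign R (w j) - x j)))
  (fun w => expR_ge0 _).
have -> : (fun t => expR (\sum_j lam j *
     (coin_sign R (nth w0 (enum {ffun 'I_n * 'I_(N ^ 2) -> bool}) t j) - x j))) =
   (fun t => expR (\sum_(i < n) u i ord0 * tnth (xi t) i)).
  apply/funext => t; congr expR.
  under [RHS]eq_bigr => i _ do rewrite /= tnth_mktuple mulrA mulr_sumr.
  by rewrite [RHS]pair_big/=; apply: eq_bigr => -[i k] _.
move=> ->; rewrite lee_fin; apply: (le_trans (coins_mgf _ hx)).
(* Per coordinate the exponent is [8 N^2 (u_i sg / N)^2 = (4 sg)^2 u_i^2 / 2]: the [N^2] signs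
   cancel the scaling, and the parameter is [4 sg]. *)
rewrite ler_expR l2norm_sqr.
have -> : \sum_j lam j ^+ 2 = \sum_(i < n) \sum_(k < N ^ 2) (u i ord0 * (sg / N%:R)) ^+ 2.
  by rewrite pair_big/=; apply: eq_bigr => -[i k] _.
under eq_bigr do rewrite sumr_const card_ord.
have N0R : N%:R != 0 :> R by rewrite pnatr_eq0 -lt0n.
rewrite !mulr_sumr mulr_suml;
apply: ler_sum => i _.
rewrite -[X in 8 * X]mulr_natl natrX le_eqVlt; apply/orP; left; apply/eqP.
by field.
Qed.
End noise.

(** The prior is uniform over placements [f], with [iota b l] the place [l] of block [b]. Summing
    over blocks makes the signal additive in the blocks. *)
Definition spikes (R : realType) (p : nat) (B : finType) (k : nat)
    (iota : B -> 'I_k -> 'I_p) (a : R) (f : {ffun B -> 'I_k}) : 'cV[R]_p :=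
  \col_i \sum_b (if iota b (f b) == i then a else 0).

Section spikes.
Context (R : realType) (p : nat) (B : finType) (k : nat).
Variables (iota : B -> 'I_k -> 'I_p) (a : R).
Hypothesis a0 : 0 <= a.
Hypothesis iotaI : forall b l b' l', iota b l = iota b' l' -> b = b' /\ l = l'.
Implicit Types f : {ffun B -> 'I_k}.

Lemma spikesE f b l : spikes iota a f (iota b l) ord0 = if l == f b then a else 0.
Proof.
rewrite mxE (bigD1 b)//= big1 ?addr0 => [|b' b'b].
  congr (if _ then _ else _); apply/eqP/eqP => [|->//].
  by move/iotaI => [].
by case: eqP => // /iotaI[bb']; rewrite bb' eqxx in b'b.
Qed.

Lemma spikes_neq0 f i : spikes iota a f i ord0 != 0 -> exists b, i = iota b (f b).
Proof.
rewrite mxE; apply: contra_neqP => /forallNP hi; apply: big1 => b _.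
by case: eqP => // /esym /hi.
Qed.

Lemma mulmx_spikes n (X : 'M[R]_(n, p)) f i :
  (X *m spikes iota a f) i ord0 = \sum_b a * X i (iota b (f b)).
Proof.
rewrite mxE; under eq_bigr do rewrite mxE mulr_sumr.
rewrite exchange_big/=; apply: eq_bigr => b _.
rewrite (bigD1 (iota b (f b)))//= eqxx big1 ?addr0 1?mulrC// => j.
by rewrite eq_sym => /negPf ->; rewrite mulr0.
Qed.

(** Turns an estimate into a test of the place in each block. *)
Definition block_guess (l0 : 'I_k) (y : 'cV[R]_p) (b : B) : 'I_k :=
  [arg max_(l > l0) y (iota b l) ord0]%O.

(** If the estimate takes values [t] at the true place and [u >= t] at the guessed one, then [2 ((a
    - t)^2 + u^2) >= (a + u - t)^2 >= a^2]. *)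
Lemma spikes_loss f l0 (y : 'cV[R]_p) :
  \sum_(b | block_guess l0 y b != f b) a ^+ 2 / 2 <=
  l2norm (y - spikes iota a f) ^+ 2.
Proof.
rewrite l2norm_sqr.
have -> : \sum_i (y - spikes iota a f) i ord0 ^+ 2 =
  \sum_i (y i ord0 - spikes iota a f i ord0) ^+ 2.
  by apply: eq_bigr => i _; rewrite !mxE.
pose z i := (y i ord0 - spikes iota a f i ord0) ^+ 2.
have z0 i : 0 <= z i by exact: sqr_ge0.
pose io (c : B * 'I_k) := iota c.1 c.2.
have ioI : injective io by move=> [b l] [b' l'] /iotaI/= [-> ->].
apply: le_trans (ler_sum_inj xpredT ioI z0).
have -> : \sum_c z (io c) = \sum_b \sum_l z (iota b l).
  by rewrite pair_big.
rewrite [leLHS]big_mkcond; apply: ler_sum => b _.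
case: ifPn => [|_]; last by apply: sumr_ge0 => l _; exact: z0.
rewrite /block_guess; case: (@arg_maxP _ _ _ l0 xpredT (fun l => y (iota b l) ord0)) => //= l _ hl lf.
rewrite (bigD1 (f b))//= (bigD1 l)//= addrA.
apply: (@le_trans _ _ (z (iota b (f b)) + z (iota b l))); last first.
  by rewrite lerDl; apply: sumr_ge0 => i _; exact: z0.
rewrite /z !spikesE eqxx (negPf lf) subr0.
have := hl (f b) isT; set t := y (iota b (f b)) _; set u := y (iota b l) _ => tu.
have := sqr_ge0 (a - t - u); have : 0 <= u - t by rewrite subr_ge0.
have : 0 <= (u - t) * (2 * a + (u - t)).
  have ut : 0 <= u - t by rewrite subr_ge0.
  by rewrite mulr_ge0// addr_ge0// mulr_ge0.
nra.
Qed.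

End spikes.

Lemma exists_ge_mean (R : realType) (I : finType) (i0 : I) (F : I -> R) (c : R) :
  c * #|I|%:R <= \sum_i F i -> exists i, c <= F i.
Proof.
move=> h; apply: contrapT => /forallNP hF; move: h; apply/negP; rewrite -ltNge.
have -> : c * #|I|%:R = \sum_(i : I) c by rewrite sumr_const mulr_natr.
have hlt i : F i < c by rewrite ltNge; apply/negP; exact: hF.
apply: ltr_sum => [|i _]; last exact: hlt.
by apply/hasP; exists i0; rewrite ?mem_index_enum.
Qed.

(** The worst case dominates the average over placements, and the loss dominates the cost of the
    decoding errors. The noise law may vary with the placement. *)
Lemma worst_case_risk_ge (R : realType) (n p m k s s0 : nat) (X : 'M[R]_(n, p))
    (G : 'I_m -> {set 'I_p}) (sigma : R) (betahat : n.-tuple R -> p.-tuple R)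
    (B : finType) (iota : B -> 'I_k -> 'I_p) (a V : R) :
  (4 <= k)%N -> 0 <= a -> 0 < sigma ->
  (forall b l b' l', iota b l = iota b' l' -> b = b' /\ l = l') ->
  (forall f, double_sparse G s s0 (spikes iota a f)) ->
  (forall b l, \sum_i X i (iota b l) ^+ 2 <= V) ->
  expR (32 * (a ^+ 2 * V / sigma ^+ 2)) <= k%:R / 2 ->
  ((7 / 48 * #|B|%:R * a ^+ 2)%:E <= worst_case_risk X G s s0 sigma betahat)%E.
Proof.
move=> k4 a0 sig0 iotaI hsp hX he.
have l0 : 'I_k by exists 0%N; rewrite (leq_trans _ k4).
pose sg := sigma / 4; have sg0 : 0 < sg by rewrite divr_gt0.
(* [M] dominates the total shift over any choice of places and blocks, so [N >= 2 M] puts every sign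
   mean within 1/2. *)
pose M : R := \sum_b \sum_(l < k) \sum_i `|a * X i (iota b l)| / sg.
have M0 : 0 <= M.
  by do 3! (apply: sumr_ge0 => ? _); rewrite divr_ge0// ltW.
have [N0 hN0] : exists N : nat, 2 * M <= N%:R.
  by exists (Num.truncn (2 * M)).+1; apply: ltW; exact: truncnS_gt.
pose N := N0.+1.
have N0R : 0 < N%:R :> R by rewrite ltr0n.
have hN : M / N%:R <= 2^-1.
  by rewrite ler_pdivrMr// mulrC ler_pdivlMr// mulrC (le_trans hN0)// ler_nat.
pose J := ('I_n * 'I_(N ^ 2))%type.
(* Shift of one sign mean: [N^2] such shifts times [sg / N] recover [a X_i]. *)
pose v (b : B) (l : 'I_k) (j : J) : R := a * X j.1 (iota b l) / sg / N%:R.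
have hv (f : {ffun B -> 'I_k}) (A : pred B) j : `|\sum_(b | A b) v b (f b) j| <= 2^-1.
  apply: le_trans hN; apply: (le_trans (ler_norm_sum _ _ _)).
  rewrite mulr_suml big_mkcond; apply: ler_sum => b _.
  have pos l i : 0 <= `|a * X i (iota b l)| / sg by rewrite divr_ge0// ltW.
  apply: (@le_trans _ _ (`|a * X j.1 (iota b (f b))| / sg / N%:R)).
    case: ifP => _; last by rewrite divr_ge0.
    by rewrite /v !normrM !normfV (gtr0_norm sg0) (gtr0_norm N0R).
  rewrite ler_pM2r ?invr_gt0// (bigD1 (f b))//= (bigD1 j.1)//= -addrA lerDl.
  by rewrite addr_ge0//; apply: sumr_ge0 => l _ //; apply: sumr_ge0.
pose x f (j : J) := \sum_b v b (f b) j.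
have hx (f : {ffun B -> 'I_k}) j : `|x f j| <= 2^-1 by exact: (hv f xpredT).
(* Summing over the [N^2] signs removes [N], and [1 / sg^2 = 16 / sigma^2] turns the factor 2 of
   [coins_chi2] into 32. *)
have hchi b l : expR (2 * \sum_j v b l j ^+ 2) <= k%:R / 2.
  apply: le_trans he; rewrite ler_expR.
  have -> : \sum_j v b l j ^+ 2 =
      \sum_(i < n) \sum_(kk < N ^ 2) (a * X i (iota b l) / sg / N%:R) ^+ 2.
    by rewrite pair_big/=; apply: eq_bigr => -[i kk] _.
  have -> : \sum_(i < n) \sum_(kk < N ^ 2) (a * X i (iota b l) / sg / N%:R) ^+ 2 =
     a ^+ 2 * 16 / sigma ^+ 2 * \sum_i X i (iota b l) ^+ 2.
    rewrite mulr_sumr; apply: eq_bigr => i _.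
    rewrite sumr_const card_ord -[LHS]mulr_natl natrX /sg.
    by field; rewrite !gt_eqF.
  apply: (@le_trans _ _ (2 * (a ^+ 2 * 16 / sigma ^+ 2 * V))).
    rewrite ler_wpM2l// ler_wpM2l// divr_ge0 ?sqr_ge0// mulr_ge0 ?sqr_ge0//.
  by rewrite le_eqVlt; apply/orP; left; apply/eqP; field; rewrite gt_eqF.
(* The response depends on the signs alone: centring the noise subtracts exactly the signal of the
   placement. *)
pose obs (w : {ffun J -> bool}) : n.-tuple R :=
  [tuple sg / N%:R * \sum_(kk < N ^ 2) coin_sign R (w (i, kk)) | i < n].
pose loss (f : {ffun B -> 'I_k}) w :=
  l2norm (tcol (betahat (obs w)) - spikes iota a f) ^+ 2.
pose guess b w := block_guess iota l0 (tcol (betahat (obs w))) b.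
(* The error fraction 7/24 times the cost [a^2 / 2] of an error gives 7/48. *)
have [f hf] : exists f : {ffun B -> 'I_k},
    7 / 48 * #|B|%:R * a ^+ 2 <= \sum_w coins (x f) w * loss f w.
  apply: (exists_ge_mean [ffun=> l0]).
  have := coins_blocks_error guess k4 hv hchi.
  move=> /(ler_wpM2l (_ : 0 <= a ^+ 2 / 2)) => /(_ _)/le_trans h.
  have -> : 7 / 48 * #|B|%:R * a ^+ 2 * #|{ffun B -> 'I_k}|%:R =
     a ^+ 2 / 2 * (7 / 24 * #|B|%:R * #|{ffun B -> 'I_k}|%:R) by field.
  apply: h; first by rewrite divr_ge0 ?sqr_ge0.
  rewrite mulr_sumr; apply: ler_sum => f _.
  have -> : \sum_b \sum_(w | guess b w != f b) coins (fun j => \sum_b v b (f b) j) w =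
     \sum_w \sum_(b | guess b w != f b) coins (x f) w.
    under eq_bigr do rewrite big_mkcond.
    by rewrite exchange_big/=; apply: eq_bigr => w _; rewrite -big_mkcond.
  rewrite mulr_sumr; apply: ler_sum => w _.
  have := spikes_loss a0 iotaI f l0 (tcol (betahat (obs w))).
  rewrite mulr_sumr => /(ler_wpM2l (coins_ge0 w (hx f))); apply: le_trans.
  by rewrite mulr_sumr; apply: ler_sum => b _; rewrite mulrC.
have [P [xi [dec [hsg hxi hP]]]] := coin_noise sg (isT : (0 < N)%N) (hx f).
apply: le_trans (ereal_sup_ubound _); last first.
  exists (spikes iota a f), _, _, P, xi; split => //.
  by have -> : sigma = 4 * sg by rewrite /sg; field.
rewrite /risk.
have -> : (fun w => l2norm (tcol (betahat (response X (spikes iota a f) (xi w))) -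
   spikes iota a f) ^+ 2) = (fun t => loss f (dec t)).
  apply/funext => t; rewrite /loss; congr (l2norm (tcol (betahat _) - _) ^+ 2).
  apply: eq_from_tnth => i; rewrite !tnth_mktuple hxi mulmx_spikes.
  rewrite big_split/= sumrN mulrDr addrCA -[RHS]addr0; congr (_ + _).
  rewrite /x /v/= sumr_const card_ord -[X in _ * - X]mulr_natl natrX.
  rewrite mulrN mulr_sumr mulr_sumr -sumrB big1// => b _.
  by field; rewrite !gt_eqF.
rewrite hP ?lee_fin// => w; exact: sqr_ge0.
Qed.

(** * Lower bound *)

Lemma group_l2norm_eq0 (R : realType) (p : nat) (b : 'cV[R]_p) (A : {set 'I_p}) :
  (group_l2norm b A == 0) = [forall i in A, b i ord0 == 0].
Proof.
rewrite /group_l2norm sqrtr_eq0.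
have -> : (\sum_(i in A) b i ord0 ^+ 2 <= 0) = (\sum_(i in A) b i ord0 ^+ 2 == 0).
  by rewrite [RHS]eq_le sumr_ge0 ?andbT// => i _; exact: sqr_ge0.
rewrite psumr_eq0; last by move=> i _; exact: sqr_ge0.
apply/allP/forall_inP => [h i iA|h i _].
  by have := h i (mem_index_enum i); rewrite iA sqrf_eq0.
by apply/implyP => iA; rewrite sqrf_eq0 h.
Qed.

Definition active_groups (R : realType) (p m : nat) (G : 'I_m -> {set 'I_p})
    (b : 'cV[R]_p) : {set 'I_m} := [set j | [exists i in G j, b i ord0 != 0]]%SET.

Lemma double_sparseE (R : realType) (p m : nat) (G : 'I_m -> {set 'I_p})
    (s s0 : nat) (b : 'cV[R]_p) :
  double_sparse G s s0 b <->
  (#|active_groups G b| <= s)%N /\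
  forall j, (#|[set i in G j | b i ord0 != 0%R]%SET| <= s0)%N.
Proof.
rewrite /double_sparse/=.
suff -> : (\sum_(j < m) (group_l2norm b (G j) != 0%R))%N = #|active_groups G b| by [].
rewrite -sum1_card [RHS]big_mkcond/=; apply: eq_bigr => j _.
rewrite inE group_l2norm_eq0 negb_forall_in.
by case: ifP.
Qed.

Lemma grouping_enum (p m d : nat) (G : 'I_m -> {set 'I_p}) : grouping d G ->
  exists e : 'I_m -> 'I_d -> 'I_p, (forall j t, e j t \in G j) /\
    (forall j t i, e j t \in G i -> j = i) /\
    (forall j, injective (e j)).
Proof.
case=> _ Gdis Gcard.
exists (fun j t => enum_val (cast_ord (esym (Gcard j)) t)); split; last split.
- by move=> j t; exact: enum_valP.
- move=> j t i hi; apply/eqP; apply: contraT => /Gdis.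
  by move/disjoint_setI0/setP => /(_ (enum_val (cast_ord (esym (Gcard j)) t)));
    rewrite !inE hi enum_valP.
- by move=> j t t' /enum_val_inj/cast_ord_inj.
Qed.

Lemma block_index_subproof (s k m : nat) (b : 'I_s) (l : 'I_k) :
  (s * k <= m)%N -> (b * k + l < m)%N.
Proof.
move=> skm; apply: (leq_trans _ skm).
apply: (@leq_trans (b.+1 * k)); first by rewrite mulSn addnC ltn_add2r.
by rewrite leq_mul2r ltn_ord orbT.
Qed.

Definition block_index (s k m : nat) (skm : (s * k <= m)%N) (b : 'I_s) (l : 'I_k) : 'I_m :=
  Ordinal (block_index_subproof b l skm).

Lemma block_index_inj (s k m : nat) (skm : (s * k <= m)%N) (b b' : 'I_s) (l l' : 'I_k) :
  block_index skm b l = block_index skm b' l' -> b = b' /\ l = l'.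
Proof.
move=> [e]; have k0 : (0 < k)%N by exact: leq_ltn_trans (ltn_ord l).
split; apply/val_inj => /=.
  by have := congr1 (fun z => z %/ k)%N e; rewrite !divnMDl// !divn_small// !addn0.
by have := congr1 (fun z => z %% k)%N e; rewrite !modnMDl !modn_small.
Qed.

(** Testing yields [ln (k / 2)] with [k] the integer quotient, whereas the rate contains
    [ln (e m / s)]. With [y = k / 2 >= 2], [e m / s <= 4 (k + 1) = 8 y + 4 <= 16 y <= y^5]. *)
Lemma ln_rate_le (R : realType) (m s : nat) : (0 < s)%N -> (4 * s <= m)%N ->
  ln (expR 1 * m%:R / s%:R) <= 5 * ln ((m %/ s)%:R / 2) :> R.
Proof.
move=> s0 sm; set k := (m %/ s)%N.
have k4 : (4 <= k)%N by rewrite leq_divRL.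
have k4R : 4 <= k%:R :> R by rewrite (ler_nat _ 4 k).
have s0R : 0 < s%:R :> R by rewrite ltr0n.
have m0R : 0 < m%:R :> R by rewrite ltr0n; lia.
have mk : m%:R <= (k%:R + 1) * s%:R :> R.
  by rewrite natr1 -natrM ler_nat; apply: ltnW; rewrite -ltn_divLR.
rewrite [leRHS]mulr_natl -lnXn; last by lra.
rewrite ler_ln ?posrE; last 2 first.
- by rewrite divr_gt0// mulr_gt0// expR_gt0.
- by rewrite exprn_gt0//; lra.
rewrite ler_pdivrMr//.
have := expR1_le4 R; have := expR_gt0 (1 : R) => e0 e4.
apply: (@le_trans _ _ (4 * ((k%:R + 1) * s%:R))).
  by apply: ler_pM => //; exact: ltW.
rewrite mulrA ler_pM2r//.
set y := k%:R / 2; have y2 : 2 <= y by rewrite /y; lra.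
have -> : k%:R = 2 * y by rewrite /y; field.
have h2 : 4 <= y ^+ 2 by nra.
have h4 : 16 <= y ^+ 2 * y ^+ 2 by nra.
rewrite -[5%N]/(2 + 2 + 1)%N !exprD expr1; nra.
Qed.

Section lower_bound.
Context (R : realType) (n p m d s s0 : nat) (X : 'M[R]_(n, p)).
Context (G : 'I_m -> {set 'I_p}) (sigma tau : R).
Hypotheses (n0 : (0 < n)%N) (s_gt0 : (0 < s)%N) (s0_gt0 : (0 < s0)%N).
Hypotheses (sm : (4 * s <= m)%N) (s0d : (4 * s0 <= d)%N).
Hypotheses (groupG : grouping d G) (sigma0 : 0 < sigma) (tau0 : 0 < tau).
Hypothesis colX : forall i, \sum_r X r i ^+ 2 <= n%:R * tau ^+ 2.
Variable betahat : n.-tuple R -> p.-tuple R.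

Lemma worst_case_risk_ge_ln (B : finType) (m' s' : nat)
    (iota : B -> 'I_(m' %/ s') -> 'I_p) : (0 < s')%N -> (4 * s' <= m')%N ->
  (forall b l b' l', iota b l = iota b' l' -> b = b' /\ l = l') ->
  (forall (a : R) f, double_sparse G s s0 (spikes iota a f)) ->
  ((7 / 48 / (160 * tau ^+ 2) * (sigma ^+ 2 / n%:R *
      (#|B|%:R * ln (expR 1 * m'%:R / s'%:R))))%:E
    <= worst_case_risk X G s s0 sigma betahat)%E.
Proof.
move=> s'0 sm' iotaI hsp.
have k4 : (4 <= m' %/ s')%N by rewrite leq_divRL.
have k4R : 4 <= (m' %/ s')%:R :> R by rewrite (ler_nat _ 4).
have nR : 0 < n%:R :> R by rewrite ltr0n.
have lr := ln_rate_le R s'0 sm'.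
set k := (m' %/ s')%N in iota iotaI hsp k4 k4R lr *.
have lk0 : 0 <= ln (k%:R / 2 : R) by apply: ln_ge0; lra.
(* The squared amplitude for which [32 a^2 V / sigma^2] equals [ln (k / 2)]. With the factor 5 of
   [ln_rate_le], this gives [160 = 32 * 5]. *)
pose a2 : R := sigma ^+ 2 * ln (k%:R / 2) / (32 * (n%:R * tau ^+ 2)).
have t20 : 0 < tau ^+ 2 by exact: exprn_gt0.
have den0 : 0 < 32 * (n%:R * tau ^+ 2) by rewrite !mulr_gt0.
have a20 : 0 <= a2 by rewrite divr_ge0 ?mulr_ge0 ?sqr_ge0// ltW.
apply: le_trans (@worst_case_risk_ge R n p m k s s0 X G sigma betahat B iota
  (Num.sqrt a2) (n%:R * tau ^+ 2) k4 (sqrtr_ge0 _) sigma0 iotaI (hsp _) _ _).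
- rewrite lee_fin sqr_sqrtr// /a2.
  have -> : 7 / 48 * #|B|%:R * (sigma ^+ 2 * ln (k%:R / 2) / (32 * (n%:R * tau ^+ 2)))
    = 7 / 48 / (160 * tau ^+ 2) * (sigma ^+ 2 / n%:R * (#|B|%:R * (5 * ln (k%:R / 2)))).
    by field; rewrite !gt_eqF.
  apply: ler_wpM2l; first by apply: divr_ge0; [lra|apply: mulr_ge0; [lra|exact: ltW]].
  apply: ler_wpM2l; first by apply: divr_ge0; [exact: sqr_ge0|exact: ltW].
  exact: ler_wpM2l.
- by move=> b l; exact: colX.
- rewrite sqr_sqrtr// /a2.
  have -> : 32 * (sigma ^+ 2 * ln (k%:R / 2) / (32 * (n%:R * tau ^+ 2)) *
     (n%:R * tau ^+ 2) / sigma ^+ 2) = ln (k%:R / 2).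
    by field; rewrite !gt_eqF.
  by rewrite lnK// posrE; lra.
Qed.

Lemma worst_case_risk_ge_rate :
  ((7 / 48 / (320 * tau ^+ 2) * minimax_rate n m d s s0 sigma)%:E
    <= worst_case_risk X G s s0 sigma betahat)%E.
Proof.
have [e [eG [eGj eI]]] := grouping_enum groupG.
have km : (s * (m %/ s) <= m)%N by rewrite mulnC leq_trunc_div.
have kd : (s0 * (d %/ s0) <= d)%N by rewrite mulnC leq_trunc_div.
have d0 : (0 < d)%N by lia.
have ms : (s <= m)%N by lia.
pose t0 := Ordinal d0.
(* Packing for the first term: a block is a run of groups, each represented by its coordinate [t0],
   so [s] groups are hit once each. *)
pose iota1 (b : 'I_s) l := e (block_index km b l) t0.
(* Packing for the second term: the active groups are the first [s], and each is cut into [s0] runs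
   of coordinates. *)
pose iota2 (b : 'I_s * 'I_s0) l := e (widen_ord ms b.1) (block_index kd b.2 l).
have iota1I b l b' l' : iota1 b l = iota1 b' l' -> b = b' /\ l = l'.
  move=> h; apply: (@block_index_inj _ _ _ km); apply: (eGj _ t0).
  by rewrite -/(iota1 b l) h; exact: eG.
have iota2I b l b' l' : iota2 b l = iota2 b' l' -> b = b' /\ l = l'.
  case: b b' => [b1 b2] [b1' b2']; rewrite /iota2/= => h.
  have wb : widen_ord ms b1 = widen_ord ms b1' by apply: (eGj _ (block_index kd b2 l)); rewrite h; exact: eG.
  rewrite wb in h; have [-> ->] := block_index_inj (eI _ _ _ h).
  by have -> : b1 = b1' by apply/val_inj; exact: (congr1 val wb).
have sp1 (a : R) f : double_sparse G s s0 (spikes iota1 a f).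
  apply/double_sparseE; split => [|j].
    rewrite -[X in (_ <= X)%N]card_ord -cardsT.
    apply: leq_trans (leq_imset_card (fun b => block_index km b (f b)) _).
    apply: subset_leq_card; apply/fintype.subsetP => j.
    rewrite inE => /existsP[i /andP[ij /spikes_neq0[b ib]]].
    apply/imsetP; exists b => //; apply/esym; apply: (eGj _ t0).
    by rewrite -/(iota1 b (f b)) -ib.
  apply: leq_trans (_ : #|[set e j t0]%SET| <= _)%N; last by rewrite cards1.
  apply: subset_leq_card.
  apply/fintype.subsetP => i; rewrite !inE => /andP[ij /spikes_neq0[b ib]].
  by rewrite ib -(eGj (block_index km b (f b)) t0 j) // -/(iota1 b (f b)) -ib.
have sp2 (a : R) f : double_sparse G s s0 (spikes iota2 a f).
  apply/double_sparseE; split => [|j].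
    rewrite -[X in (_ <= X)%N]card_ord -cardsT.
    apply: leq_trans (leq_imset_card (widen_ord ms) _).
    apply: subset_leq_card; apply/fintype.subsetP => j.
    rewrite inE => /existsP[i /andP[ij /spikes_neq0[b ib]]].
    apply/imsetP; exists b.1 => //; apply/esym; apply: (eGj _ (block_index kd b.2 (f b))).
    by rewrite -/(iota2 b (f b)) -ib; exact: ij.
  have [[b1 jb1]|nb] := pselect (exists b1, j = widen_ord ms b1); last first.
    rewrite (_ : [set _ in _ | _]%SET = finset.set0) ?cards0//.
    apply/setP => i; rewrite !inE; apply/negP => /andP[ij /spikes_neq0[b ib]].
    apply: nb; exists b.1; apply/esym; apply: (eGj _ (block_index kd b.2 (f b))).
    by rewrite -/(iota2 b (f b)) -ib; exact: ij.
  rewrite -[X in (_ <= X)%N]card_ord -cardsT.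
  apply: leq_trans (leq_imset_card (fun b2 => iota2 (b1, b2) (f (b1, b2))) _).
  apply: subset_leq_card; apply/fintype.subsetP => i.
  rewrite !inE => /andP[ij /spikes_neq0[[b1' b2] ib]].
  apply/imsetP; exists b2 => //; suff -> : b1 = b1' by [].
  apply/val_inj; apply: (congr1 val (_ : widen_ord ms b1 = widen_ord ms b1')).
  rewrite -jb1; apply/esym; apply: (eGj _ (block_index kd b2 (f (b1', b2)))); rewrite -/(iota2 (b1', b2) (f (b1', b2))) -ib.
  exact: ij.
have h1 := worst_case_risk_ge_ln s_gt0 sm iota1I sp1.
have h2 := worst_case_risk_ge_ln s0_gt0 s0d iota2I sp2.
rewrite card_ord in h1; rewrite card_prod !card_ord natrM in h2.
set r1 := (X in (X%:E <= _)%E) in h1; set r2 := (X in (X%:E <= _)%E) in h2.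
(* Both packings bound the same worst case, hence so does their mean; this doubles 160 to 320. *)
suff -> : 7 / 48 / (320 * tau ^+ 2) * minimax_rate n m d s s0 sigma = (r1 + r2) / 2.
  have [r12|r12] := leP r1 r2.
    by apply: le_trans h2; rewrite lee_fin; lra.
  by apply: le_trans h1; rewrite lee_fin; lra.
rewrite /r1 /r2 /minimax_rate; field.
by rewrite pnatr_eq0 -lt0n n0 gt_eqF.
Qed.

End lower_bound.

(** * Exponential moments of the score *)

Section moment.
Context (R : realType).

(** Lying under some term at each point, [f] lies under the whole nonnegative series, which is
    integrated term by term. *)
Lemma integral_le_series (dd : measure_display) (T : measurableType dd)
    (P : measure T R) (f : T -> R) (g : nat -> T -> R) (b : nat -> R) (c : R) :
  measurable_fun setT f -> (forall k, measurable_fun setT (g k)) ->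
  (forall x, 0 <= f x) -> (forall k x, 0 <= g k x) ->
  (forall x, exists k, f x <= g k x) ->
  (forall k, (\int[P]_x (g k x)%:E <= (b k)%:E)%E) ->
  (forall N, \sum_(0 <= k < N) b k <= c) ->
  (\int[P]_x (f x)%:E <= c%:E)%E.
Proof.
move=> mf mg f0 g0 fg gb bc.
have mfE : measurable_fun setT (EFin \o f) by exact/measurable_EFinP.
have mgE k : measurable_fun setT (EFin \o g k).
  exact/measurable_EFinP.
have gE0 k x : setT x -> (0 <= (g k x)%:E)%E by rewrite lee_fin.
apply: (@le_trans _ _ (\int[P]_x \sum_(0 <= k <oo) (g k x)%:E)%E).
  apply: ge0_le_integral => //.
  - by move=> x _; rewrite lee_fin.
  - apply: ge0_emeasurable_sum => [k x _ _|k _]; first by rewrite lee_fin.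
    exact: mgE.
  - move=> x _; have [k fk] := fg x.
    apply: (@le_trans _ _ (\sum_(0 <= i < k.+1) (g i x)%:E)%E); last first.
      by apply: nneseries_lim_ge => i _ _; rewrite lee_fin.
    rewrite sumEFin lee_fin big_nat_recr//=.
    by rewrite (le_trans fk)// lerDr sumr_ge0.
rewrite integral_nneseries//.
apply: lime_le; first by apply: is_cvg_nneseries => k _ _; apply: integral_ge0 => x _; exact: gE0.
apply: nearW => N; apply: (@le_trans _ _ (\sum_(0 <= k < N) (b k)%:E)%E).
  by apply: lee_sum => k _; exact: gb.
by rewrite sumEFin lee_fin.
Qed.

(* A discrete substitute for the identity e^(z^2/2) = E e^(g z) with g a standard Gaussian:
   it reduces exponential moments of squares to those of linear forms. *)
Lemma expR_half_sqr_le (z : R) : exists k : nat,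
  expR (z ^+ 2 / 2) <=
  expR ((1 - k%:R ^+ 2) / 2) * (expR (k%:R * z) + expR (- (k%:R * z))).
Proof.
(* For [k] the integer part of [|z|], the gap between the exponents is
   [(1 - (|z| - k)^2) / 2 >= 0]. *)
exists (Num.truncn `|z|).
have /andP[h1 h2] := truncn_itv (normr_ge0 z).
set k : R := (Num.truncn `|z|)%:R; rewrite -natr1 -/k in h2.
rewrite -/k in h1.
have key : expR (z ^+ 2 / 2) <= expR ((1 - k ^+ 2) / 2) * expR (k * `|z|).
  rewrite -expRD ler_expR -(real_normK (num_real z)); nra.
apply: (le_trans key); rewrite ler_wpM2l ?expR_ge0//.
have [z0|z0] := leP 0 z; first by rewrite ger0_norm// lerDl expR_ge0.
by rewrite ltr0_norm// mulrN lerDr expR_ge0.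
Qed.

(** Sum of the geometric series that dominates [2 exp (1/2 - k^2 / 4)] through [k^2 >= k]. *)
Definition moment_const : R := 2 * expR 2^-1 * (1 - expR (- 4^-1))^-1.

Lemma moment_const_ge0 : 0 <= moment_const.
Proof.
rewrite /moment_const !mulr_ge0 ?expR_ge0// invr_ge0 subr_ge0 expR_le1.
Qed.

Lemma moment_const_ge_sum N :
  \sum_(0 <= k < N) (2 * expR (2^-1 - k%:R ^+ 2 / 4)) <= moment_const.
Proof.
apply: le_trans (_ : series (geometric (2 * expR 2^-1) (expR (- 4^-1))) N <= _).
  apply: ler_sum => k _; rewrite /= -expRM_natl.
  rewrite -[leRHS]mulrA ler_wpM2l// -expRD ler_expR.
  rewrite lerD2l mulrN lerN2 ler_pM2r ?invr_gt0//.
  by rewrite -natrX ler_nat; case: k => // k; rewrite expnS leq_pmulr// expn1.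
apply: geometric_le_lim; rewrite ?expR_gt0 ?mulr_ge0 ?expR_ge0//.
by rewrite ger0_norm ?expR_ge0// expR_lt1 oppr_lt0 invr_gt0.
Qed.

Context (dd : measure_display) (T : measurableType dd) (P : probability T R).
Context (n p : nat) (X : 'M[R]_(n, p)) (xi : {RV P >-> n.-tuple R}).
Context (sigma V c : R).
Hypothesis subg : sub_gaussian xi sigma.
Hypothesis cV : c ^+ 2 * (sigma ^+ 2 * V) <= 2^-1.

Definition score (i : 'I_p) (w : T) : R := \sum_r X r i * tnth (xi w) r.

Lemma measurable_noise r : measurable_fun setT (fun w => tnth (xi w) r).
Proof. exact: (measurableT_comp (measurable_tnth r)). Qed.

Lemma measurable_score i : measurable_fun setT (score i).
Proof.
apply: measurable_sum => r.
by apply: measurable_funM => //; exact: measurable_noise.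
Qed.

(** Interpolates between a linear form in the scores ([l] empty) and half the sum of their scaled
    squares ([u = 0]); [l] lists the squares not yet linearized. *)
Definition tilt (l : seq 'I_p) (u : 'cV[R]_p) (w : T) : R :=
  \sum_i u i ord0 * score i w + \sum_(i <- l) (c * score i w) ^+ 2 / 2.

Lemma measurable_tilt l u : measurable_fun setT (fun w => expR (tilt l u w)).
Proof.
apply: measurableT_comp => //; apply: measurable_funD.
  apply: measurable_sum => i.
  by apply: measurable_funM => //; exact: measurable_score.
apply: measurable_sum => i.
apply: measurable_funM => //.
apply: measurable_funX.
by apply: measurable_funM => //; exact: measurable_score.
Qed.

(** Induction on [l]: [expR_half_sqr_le] trades the square at [i] for linear terms [k c] and [- k c]
    at [i], each step costing a factor [moment_const]. With no square left, sub-Gaussianity in the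
    direction [X u] concludes. *)
Lemma tilt_moment (S : {set 'I_p}) (l : seq 'I_p) (u : 'cV[R]_p) :
  (forall v : 'cV[R]_p, (forall i, v i ord0 != 0 -> i \in S) ->
     l2norm (X *m v) ^+ 2 <= V * l2norm v ^+ 2) ->
  uniq l -> {subset l <= S} ->
  (forall i, u i ord0 != 0 -> (i \in S) && (i \notin l)) ->
  (\int[P]_w (expR (tilt l u w))%:E <=
    (moment_const ^+ size l * expR (sigma ^+ 2 * V * l2norm u ^+ 2 / 2))%:E)%E.
Proof.
move=> hS; elim: l u => [|i l IH] u.
  move=> _ _ hu; rewrite expr0 mul1r.
  have := subg (X *m u); rewrite expectation.unlock.
  have -> : (fun w => (expR (\sum_r (X *m u) r ord0 * tnth (xi w) r))%:E) =
            (fun w => (expR (tilt [::] u w))%:E).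
    apply/funext => w; rewrite /tilt big_nil addr0; congr (expR _)%:E.
    under eq_bigr do rewrite mxE mulr_suml.
    rewrite exchange_big/=; apply: eq_bigr => i _.
    rewrite mulr_sumr; apply: eq_bigr => r _; ring.
  move=> h; apply: (le_trans h); rewrite lee_fin ler_expR.
  rewrite ler_pM2r ?invr_gt0// -mulrA ler_wpM2l ?sqr_ge0//; apply: hS => i /hu.
  by case/andP.
move=> /= /andP[il ul] lS hu.
have iS : i \in S by apply: lS; rewrite inE eqxx.
have ui : u i ord0 = 0.
  by apply: contraTeq isT => /hu; rewrite inE eqxx andbF.
pose shift (k : R) := u + k *: delta_mx i ord0.
have shiftE k j : shift k j ord0 = if j == i then k else u j ord0.
  rewrite !mxE eqxx andbT; case: eqP => [->|_]; first by rewrite ui add0r mulr1.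
  by rewrite mulr0 addr0.
have shift_norm k : l2norm (shift k) ^+ 2 = k ^+ 2 + l2norm u ^+ 2.
  rewrite !l2norm_sqr (bigD1 i)//= [in RHS](bigD1 i)//= shiftE eqxx ui expr0n add0r.
  by congr (_ + _); apply: eq_bigr => j /negPf ji; rewrite shiftE ji.
have tiltE k w : tilt l (shift k) w = tilt l u w + k * score i w.
  rewrite /tilt (bigD1 i)//= [in RHS](bigD1 i)//= shiftE eqxx ui mul0r add0r.
  rewrite (eq_bigr (fun j => u j ord0 * score j w)); last first.
    by move=> j /negPf ji; rewrite shiftE ji.
  ring.
have shiftI k : (\int[P]_w (expR (tilt l (shift k) w))%:E <=
   (moment_const ^+ size l * expR (sigma ^+ 2 * V * (k ^+ 2 + l2norm u ^+ 2) / 2))%:E)%E.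
  rewrite -shift_norm; apply: IH => //; first by move=> j jl; apply: lS; rewrite inE jl orbT.
  move=> j; rewrite shiftE; case: (j =P i) => [->|_ /hu]; first by rewrite iS il.
  by rewrite inE negb_or => /andP[-> /andP[]].
pose K := moment_const ^+ size l * expR (sigma ^+ 2 * V * l2norm u ^+ 2 / 2).
have K0 : 0 <= K by rewrite mulr_ge0 ?expR_ge0 ?exprn_ge0 ?moment_const_ge0.
pose wt (k : nat) : R := expR ((1 - k%:R ^+ 2) / 2).
apply: (@integral_le_series _ _ P (fun w => expR (tilt (i :: l) u w))
  (fun k w => wt k * (expR (tilt l (shift (k%:R * c)) w) +
                      expR (tilt l (shift (- (k%:R * c))) w)))
  (fun k => 2 * expR (2^-1 - k%:R ^+ 2 / 4) * K)) => //.
- exact: measurable_tilt.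
- move=> k; apply: measurable_funM => //.
  by apply: measurable_funD; exact: measurable_tilt.
- by move=> k w; rewrite mulr_ge0 ?addr_ge0 ?expR_ge0.
- move=> w; have [k hk] := expR_half_sqr_le (c * score i w).
  exists k; rewrite !tiltE {1}/tilt big_cons addrCA -/(tilt l u w) [leLHS]expRD [X in _ <= _ * X](_ : _ =
    (expR (k%:R * (c * score i w)) + expR (- (k%:R * (c * score i w)))) *
      expR (tilt l u w)).
    by rewrite [leRHS]mulrA ler_wpM2r ?expR_ge0.
  by rewrite mulrDl -!expRD; congr (expR _ + expR _); ring.
- move=> k.
  have mE v : measurable_fun setT (EFin \o (fun w => expR (tilt l v w))).
    by apply/measurable_EFinP; exact: measurable_tilt.
  under eq_integral do rewrite EFinM EFinD.
  rewrite ge0_integralZl//; last first.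
  + by rewrite lee_fin expR_ge0.
  + by move=> w _; rewrite -EFinD lee_fin addr_ge0 ?expR_ge0.
  + by apply: emeasurable_funD; exact: mE.
  rewrite ge0_integralD//; try (exact: mE); try by move=> w _; rewrite lee_fin expR_ge0.
  apply: (@le_trans _ _ ((wt k)%:E * ((K * expR (k%:R ^+ 2 / 4))%:E +
       (K * expR (k%:R ^+ 2 / 4))%:E))%E).
    (* By [cV] the new coordinate costs at most [k^2 / 4] in the exponent, half of the [k^2 / 2]
       supplied by [wt k], so the series converges. *)
    have hK (q : R) : q ^+ 2 = (k%:R * c) ^+ 2 -> moment_const ^+ size l *
        expR (sigma ^+ 2 * V * (q ^+ 2 + l2norm u ^+ 2) / 2) <= K * expR (k%:R ^+ 2 / 4).
      move=> ->; rewrite /K -[leRHS]mulrA ler_wpM2l ?exprn_ge0 ?moment_const_ge0//.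
      rewrite -expRD ler_expR.
      have := ler_wpM2l (sqr_ge0 (k%:R : R)) cV; lra.
    apply: lee_wpmul2l; first by rewrite lee_fin expR_ge0.
    apply: leeD; apply: (le_trans (shiftI _)); rewrite lee_fin; apply: hK => //.
    by rewrite sqrrN.
  rewrite -EFinD -EFinM lee_fin /wt.
  have -> : 2 * expR (2^-1 - k%:R ^+ 2 / 4) =
      2 * (expR ((1 - k%:R ^+ 2) / 2) * expR (k%:R ^+ 2 / 4)) :> R.
    by rewrite -expRD; congr (_ * expR _); field.
  by rewrite le_eqVlt; apply/orP; left; apply/eqP; ring.
- move=> N; rewrite -mulr_suml exprS -[leRHS]mulrA -/K ler_wpM2r//.
  exact: moment_const_ge_sum.
Qed.

Lemma score_moment (S : {set 'I_p}) :
  (forall v : 'cV[R]_p, (forall i, v i ord0 != 0 -> i \in S) ->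
     l2norm (X *m v) ^+ 2 <= V * l2norm v ^+ 2) ->
  (\int[P]_w (expR (c ^+ 2 / 2 * \sum_(i in S) score i w ^+ 2))%:E <=
    (moment_const ^+ #|S|)%:E)%E.
Proof.
move=> hS; have := @tilt_moment S (enum S) 0 hS (enum_uniq _).
have -> : l2norm (0 : 'cV[R]_p) ^+ 2 = 0.
  by rewrite l2norm_sqr big1// => i _; rewrite mxE expr0n.
rewrite mulr0 mul0r expR0 mulr1 -cardE => h.
apply: le_trans (h _ _) => [|i|i]; last 2 first.
- by rewrite mem_enum.
- by rewrite mxE eqxx.
rewrite le_eqVlt; apply/orP; left; apply/eqP; apply: eq_integral => w _.
congr (expR _)%:E; rewrite /tilt [X in X + _]big1 => [|i _]; last by rewrite mxE mul0r.
rewrite add0r big_enum/= mulr_sumr; apply: eq_bigr => i _.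
by rewrite exprMn mulrAC.
Qed.

End moment.

(** * Counting double-sparse supports *)

Lemma sum_subset_exp (R : realType) (I : finType) (A : {set I}) (r : R) : 0 <= r ->
  \sum_(T : {set I} | T \subset A) r ^+ #|T| <= (1 + r) ^+ #|A|.
Proof.
move=> r0.
have -> : (1 + r) ^+ #|A| = \prod_i ((if i \in A then r else 0) + 1).
  rewrite (bigID (mem A))/= [X in _ * X]big1 => [|i /negPf ->]; last by rewrite add0r.
  rewrite mulr1 -prodr_const; apply: eq_bigr => i ->; exact: addrC.
rewrite bigA_distr [leLHS]big_mkcond/=; apply: ler_sum => T _; case: ifPn => [TA|_].
  rewrite le_eqVlt; apply/orP; left; apply/eqP.
  rewrite -prodr_const big_mkcond/=; apply: eq_bigr => i _.
  by case: ifP => // iT; rewrite (fintype.subsetP TA).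
by apply: prodr_ge0 => i _; do 2?case: ifP.
Qed.

Definition sparse_support (p m : nat) (G : 'I_m -> {set 'I_p}) (a b : nat)
    (S : {set 'I_p}) : bool :=
  (#|[set j | G j :&: S != finset.set0]%SET| <= a)%N &&
  [forall j, #|G j :&: S|%SET <= b]%N.

(* Generating function: in the sum over all supports, a nonempty group gets weight
   t / r^b and each of its indices weight r. *)
Lemma card_sparse_support (R : realType) (p m d : nat) (G : 'I_m -> {set 'I_p})
    (a b : nat) (t r : R) : grouping d G -> 0 < t <= 1 -> 0 < r <= 1 ->
  #|[pred S | sparse_support G a b S]|%:R * t ^+ a <=
    expR (m%:R * (t / r ^+ b * expR (d%:R * r))).
Proof.
move=> [Gcov Gdis Gcard] /andP[t0 t1] /andP[r0 r1].
pose phi (T : {set 'I_p}) : R := if T == finset.set0 then 1 else t / r ^+ b * r ^+ #|T|.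
have rb0 : 0 < r ^+ b by exact: exprn_gt0.
have phi0 T : 0 <= phi T.
  by rewrite /phi; case: ifP => // _; rewrite mulr_ge0 ?divr_ge0 ?exprn_ge0// ltW.
pose F (f : {ffun 'I_m -> {set 'I_p}}) : R :=
  \prod_j (if f j \subset G j then phi (f j) else 0).
have F0 f : 0 <= F f by apply: prodr_ge0 => j _; case: ifP.
(* A support is encoded by its traces on the groups; this is injective because the groups cover all
   indices. *)
pose h (S : {set 'I_p}) : {ffun 'I_m -> {set 'I_p}} := [ffun j => (G j :&: S)%SET].
have hI : injective h.
  move=> S S' /ffunP SS'; apply/setP => i.
  have /bigcupP[j _ ij] : i \in (\bigcup_(j < m) G j)%SET by rewrite Gcov inE.
  by have := SS' j; rewrite !ffunE => /setP/(_ i); rewrite !inE ij.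
have hS S : sparse_support G a b S -> t ^+ a <= F (h S).
  move=> /andP[aS /forallP bS].
  apply: (@le_trans _ _ (\prod_j (if j \in [set j | G j :&: S != finset.set0]%SET then t else 1))).
    rewrite -big_mkcond/= prodr_const; apply: ler_wiXn2l => //; exact: ltW.
  apply: ler_prod => j _; rewrite inE; apply/andP; split; first by case: ifP => // _; exact: ltW.
  rewrite ffunE finset.subsetIl /phi; case: eqP => //= _.
  (* A nonempty trace [T] has weight [t r^(|T| - b) >= t], since [|T| <= b] and [r <= 1]. *)
  rewrite mulrAC ler_pdivlMr// ler_pM2l//; apply: ler_wiXn2l => //; exact: ltW.
rewrite mulrC mulr_natr -sumr_const.
apply: (@le_trans _ _ (\sum_(S | sparse_support G a b S) F (h S))).
  by apply: ler_sum => S; exact: hS.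
apply: (le_trans (ler_sum_inj _ hI F0)).
rewrite /F -(bigA_distr_bigA (fun j (T : {set 'I_p}) => if T \subset G j then phi T else 0)).
rewrite mulr_natl -[X in _ *+ X](card_ord m) -sumr_const expR_sum.
apply: ler_prod => j _; rewrite sumr_ge0/=; last by move=> T _; case: ifP.
apply: le_trans (expR_ge1Dx _).
(* The empty trace contributes the 1 of [1 + x <= e^x]. *)
rewrite (bigD1 finset.set0)//= finset.sub0set {1}/phi eqxx lerD2l -big_mkcondr/=.
apply: (@le_trans _ _ (t / r ^+ b * \sum_(T : {set 'I_p} | T \subset G j) r ^+ #|T|)).
  rewrite mulr_sumr [leLHS]big_mkcond [leRHS]big_mkcond/=.
  apply: ler_sum => T _; rewrite /phi.
  case: (T == finset.set0) => //=; case: (T \subset G j) => //=.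
  by rewrite mulr_ge0 ?divr_ge0 ?exprn_ge0// ltW.
apply: ler_wpM2l; first by rewrite divr_ge0// ltW.
apply: (le_trans (sum_subset_exp _ (ltW r0))).
rewrite Gcard expRM_natl lerXn2r// ?nnegrE ?expR_ge0 ?expR_ge1Dx//.
by rewrite addr_ge0// ltW.
Qed.

Definition entropy (R : realType) (m d s s0 : nat) : R :=
  s%:R * ln (expR 1 * m%:R / s%:R) + s%:R * s0%:R * ln (expR 1 * d%:R / s0%:R).

Lemma card_sparse_support_entropy (R : realType) (p m d s s0 : nat)
    (G : 'I_m -> {set 'I_p}) : grouping d G ->
  (0 < s)%N -> (0 < s0)%N -> (s <= m)%N -> (s0 <= d)%N ->
  #|[pred S | sparse_support G (2 * s) (2 * s0) S]|%:R <=
    expR (4 * entropy R m d s s0).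
Proof.
move=> groupG s_gt0 s0_gt0 sm s0d.
have sR : 0 < s%:R :> R by rewrite ltr0n.
have s0R : 0 < s0%:R :> R by rewrite ltr0n.
have mR : 0 < m%:R :> R by rewrite ltr0n; lia.
have dR : 0 < d%:R :> R by rewrite ltr0n; lia.
(* With [d r = s0], the [t] below makes the generating-function exponent [m t r^(- 2 s0) e^(d r)]
   equal to [s]. *)
pose r : R := s0%:R / d%:R.
have r0 : 0 < r by rewrite divr_gt0.
have r1 : r <= 1 by rewrite ler_pdivrMr// mul1r ler_nat.
pose t : R := s%:R / m%:R * r ^+ (2 * s0) * expR (- s0%:R).
have t0 : 0 < t by rewrite !mulr_gt0 ?expR_gt0 ?exprn_gt0 ?invr_gt0.
have t1 : t <= 1.
  have sm0 : 0 <= s%:R / m%:R :> R by rewrite divr_ge0.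
  have sm1 : s%:R / m%:R <= 1 :> R by rewrite ler_pdivrMr// mul1r ler_nat.
  have rs0 : 0 <= r ^+ (2 * s0) by rewrite exprn_ge0// ltW.
  have rs1 : r ^+ (2 * s0) <= 1 by rewrite exprn_ile1// ltW.
  have e1 : expR (- s0%:R) <= 1 :> R by rewrite expR_le1 oppr_le0.
  have p0 := mulr_ge0 sm0 rs0; have p1 := mulr_ile1 sm0 rs0 sm1 rs1.
  exact: mulr_ile1 p0 (expR_ge0 _) p1 e1.
have := @card_sparse_support R p m d G (2 * s) (2 * s0) t r groupG.
rewrite t0 t1 r0 r1 => /(_ isT isT).
have -> : m%:R * (t / r ^+ (2 * s0) * expR (d%:R * r)) = s%:R.
  have -> : d%:R * r = s0%:R by rewrite /r; field; rewrite gt_eqF.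
  rewrite /t expRN; field.
  by rewrite !gt_eqF ?expR_gt0 ?exprn_gt0.
rewrite -ler_pdivlMr ?exprn_gt0// => h; apply: (le_trans h).
have lm : ln (expR 1 * m%:R / s%:R) = 1 - ln (s%:R / m%:R) :> R.
  rewrite -mulrA lnM ?posrE ?expR_gt0 ?divr_gt0// expRK; congr (_ + _).
  by rewrite -lnV ?posrE ?divr_gt0// invf_div.
have ld : ln (expR 1 * d%:R / s0%:R) = 1 - ln r :> R.
  rewrite -mulrA lnM ?posrE ?expR_gt0 ?divr_gt0// expRK; congr (_ + _).
  by rewrite -lnV ?posrE ?divr_gt0// invf_div.
have lt : ln t = ln (s%:R / m%:R) + (2 * s0)%:R * ln r - s0%:R.
  have q0 : 0 < s%:R / m%:R :> R by rewrite divr_gt0.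
  have q1 : 0 < r ^+ (2 * s0) by rewrite exprn_gt0.
  rewrite /t lnM ?posrE ?expR_gt0 ?(mulr_gt0 q0 q1)// expRK.
  by rewrite lnM ?posrE// lnXn// -[ln r *+ _]mulr_natl.
rewrite -[X in _ / X ^+ _]lnK ?posrE// -expRM_natl -expRN -expRD ler_expR.
(* The count is at most [e^s t^(- 2 s)], with logarithm [s + 2 s ln (m / s) + 4 s s0 ln (d / s0) + 2
   s s0]. *)
rewrite /entropy lm ld lt !natrM.
have l1 : ln (s%:R / m%:R) <= 0 :> R.
  by apply: ln_le0; rewrite ler_pdivrMr// mul1r ler_nat.
have l2 : s%:R * s0%:R * ln r <= 0 :> R.
  by rewrite mulr_ge0_le0 ?mulr_ge0//; exact: ln_le0.
have l3 : s%:R * ln (s%:R / m%:R) <= 0 :> R by rewrite mulr_ge0_le0.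
have l4 : 0 <= s%:R * s0%:R :> R by rewrite mulr_ge0.
lra.
Qed.

(** * Near minimizers of the residual *)

Section least_squares.
Context (R : realType) (n p m : nat) (X : 'M[R]_(n, p)).
Context (G : 'I_m -> {set 'I_p}) (s s0 : nat).

Lemma l2norm_sub_sqr k (u v : 'cV[R]_k) :
  l2norm (u - v) ^+ 2 = \sum_r (u r ord0 - v r ord0) ^+ 2.
Proof. by rewrite l2norm_sqr; apply: eq_bigr => r _; rewrite !mxE. Qed.

Definition rss (y : n.-tuple R) (b : 'cV[R]_p) : R := l2norm (tcol y - X *m b) ^+ 2.

Lemma rssE y b : rss y b = \sum_r (tnth y r - (X *m b) r ord0) ^+ 2.
Proof. by rewrite /rss l2norm_sub_sqr; apply: eq_bigr => r _; rewrite [tcol y _ _]mxE. Qed.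

(** Countability makes the minimizing index measurable. Codes that decode to nothing admissible fall
    back to 0, which is double sparse. *)
Definition rational_sparse (k : nat) : 'cV[R]_p :=
  if (unpickle k : option {ffun 'I_p -> rat}) is Some f then
    if `[< double_sparse G s s0 (\col_i ratr (f i) : 'cV[R]_p) >]
    then \col_i ratr (f i) else 0
  else 0.

Lemma double_sparse_supp (a b : nat) (u v : 'cV[R]_p) :
  (forall i, v i ord0 != 0 -> u i ord0 != 0) ->
  double_sparse G a b u -> double_sparse G a b v.
Proof.
move=> uv /double_sparseE[hu1 hu2]; apply/double_sparseE; split => [|j].
  apply: leq_trans hu1; apply: subset_leq_card; apply/fintype.subsetP => j.
  rewrite !inE => /existsP[i /andP[ij vi]]; apply/existsP; exists i.
  by rewrite ij uv.
apply: leq_trans (hu2 j); apply: subset_leq_card; apply/fintype.subsetP => i.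
by rewrite !inE => /andP[-> /uv].
Qed.

Lemma double_sparse0 a b : double_sparse G a b (0 : 'cV[R]_p).
Proof.
apply/double_sparseE; split => [|j].
  rewrite /active_groups (_ : [set _ | _]%SET = finset.set0) ?cards0//.
  apply/setP => j; rewrite !inE; apply/negbTE/existsPn => i.
  by rewrite mxE eqxx andbF.
rewrite (_ : [set _ in _ | _]%SET = finset.set0) ?cards0//.
by apply/setP => i; rewrite !inE mxE eqxx andbF.
Qed.

Lemma rational_sparseP k : double_sparse G s s0 (rational_sparse k).
Proof.
rewrite /rational_sparse; case: unpickle => [f|]; last exact: double_sparse0.
by case: asboolP => // _; exact: double_sparse0.
Qed.

Lemma rational_sparse_dense (b : 'cV[R]_p) (eta : R) : 0 < eta ->
  double_sparse G s s0 b ->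
  exists k, forall i, `|rational_sparse k i ord0 - b i ord0| <= eta.
Proof.
move=> eta0 hb.
(* Zero is approximated by zero exactly, so the approximation does not enlarge the support. *)
have hq (x : R) : exists q : rat, `|ratr q - x| <= eta /\ (x = 0 -> q = 0).
  have [->|x0] := eqVneq x 0.
    by exists 0; rewrite rmorph0 subrr normr0 ltW.
  have /rat_in_itvoo[q] : x - eta < x + eta by lra.
  rewrite in_itv/= => /andP[h1 h2]; exists q; split; last by move/eqP; rewrite (negPf x0).
  by rewrite ler_norml; apply/andP; split; lra.
have [q hqb] := choice hq.
pose f : {ffun 'I_p -> rat} := [ffun i => q (b i ord0)].
exists (pickle f) => i.
rewrite /rational_sparse pickleK; case: asboolP => [_|]; last first.
  case; apply: double_sparse_supp hb => j; rewrite mxE ffunE.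
  by apply: contra_neq => /(hqb _).2 ->; rewrite rmorph0.
by rewrite mxE ffunE; exact: (hqb _).1.
Qed.

Lemma rss_dense (y : n.-tuple R) (b : 'cV[R]_p) (eps : R) : 0 < eps ->
  double_sparse G s s0 b -> exists k, rss y (rational_sparse k) <= rss y b + eps.
Proof.
move=> eps0 hb.
pose e r := tnth y r - (X *m b) r ord0.
pose A r := \sum_i `|X r i|.
have A0 r : 0 <= A r by exact: sumr_ge0.
pose C := \sum_r (2 * `|e r| * A r + A r ^+ 2).
have C0 : 0 <= C.
  by apply: sumr_ge0 => r _; rewrite addr_ge0 ?sqr_ge0// !mulr_ge0.
(* The cap at 1 gives [eta^2 <= eta], making the increase of the residual at most [eta C]; [C + 1]
   keeps the denominator positive. *)
pose eta := Num.min 1 (eps / (C + 1)).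
have eta0 : 0 < eta by rewrite lt_min ltr01 divr_gt0//; lra.
have eta1 : eta <= 1 by rewrite ge_min lexx.
have etaC : eta * C <= eps.
  apply: (@le_trans _ _ (eps / (C + 1) * C)).
    by rewrite ler_wpM2r// ge_min lexx orbT.
  rewrite mulrAC ler_pdivrMr; last by lra.
  by nra.
have [k hk] := rational_sparse_dense eta0 hb.
exists k; set b' := rational_sparse k in hk *.
apply: le_trans (lerD (lexx _) etaC); rewrite !rssE mulr_sumr -big_split/=.
apply: ler_sum => r _; rewrite -/(e r).
pose D := (X *m b') r ord0 - (X *m b) r ord0.
have hD : `|D| <= eta * A r.
  rewrite /D !mxE -sumrB mulr_sumr; apply: (le_trans (ler_norm_sum _ _ _)).
  by apply: ler_sum => i _; rewrite -mulrBr normrM mulrC ler_wpM2r.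
have -> : tnth y r - (X *m b') r ord0 = e r - D by rewrite /e /D; ring.
have h1 : - (2 * (e r * D)) <= 2 * (`|e r| * (eta * A r)).
  rewrite -mulrN ler_wpM2l//; apply: (le_trans (ler_norm _)).
  by rewrite normrN normrM ler_wpM2l.
have h2 : D ^+ 2 <= eta * A r ^+ 2.
  rewrite -real_normK ?num_real//; apply: (@le_trans _ _ ((eta * A r) ^+ 2)).
    by rewrite lerXn2r ?nnegrE ?mulr_ge0// ltW.
  by rewrite exprMn ler_wpM2r ?sqr_ge0// expr2 ler_piMr// ltW.
have -> : (e r - D) ^+ 2 = e r ^+ 2 + - (2 * (e r * D)) + D ^+ 2 by ring.
have -> : e r ^+ 2 + eta * (2 * `|e r| * A r + A r ^+ 2) =
  e r ^+ 2 + 2 * (`|e r| * (eta * A r)) + eta * A r ^+ 2 by ring.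
by rewrite lerD// lerD2l.
Qed.

Variable eps : R.
Hypothesis eps0 : 0 < eps.

Definition near_min (y : n.-tuple R) (k : nat) : bool :=
  `[< forall l, rss y (rational_sparse k) <= rss y (rational_sparse l) + eps >].

Lemma near_min_exists y : exists k, near_min y k.
Proof.
pose E := [set x | exists k, x = rss y (rational_sparse k)].
have lE : lbound E 0 by move=> x [k ->]; exact: sqr_ge0.
have hE : has_inf E.
  by split; [exists (rss y (rational_sparse 0)); exists 0%N | exists 0].
have [x [k ->] hk] := inf_adherent eps0 hE.
exists k; apply/asboolP => l; apply: ltW; apply: (lt_le_trans hk).
rewrite lerD2r; apply: ge_inf; last by exists l.
by exists 0.
Qed.

(** Taking the least index makes the selection measurable: it equals [k] where [k] is near minimal
    and no smaller index is. *)
Definition near_min_index (y : n.-tuple R) : nat := ex_minn (near_min_exists y).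

Lemma measurable_rss b : measurable_fun setT (fun y : n.-tuple R => rss y b).
Proof.
under eq_fun do rewrite rssE.
apply: measurable_sum => r; apply: measurable_funX; apply: measurable_funB => //.
exact: measurable_tnth.
Qed.

Lemma measurable_near_min k : measurable [set y | near_min y k].
Proof.
have -> : [set y | near_min y k] = \bigcap_l
    [set y | rss y (rational_sparse k) <= rss y (rational_sparse l) + eps].
  apply/seteqP; split => y /= h; first by move=> l _; move/asboolP: h; apply.
  by apply/asboolP => l; exact: h.
apply: bigcap_measurable => // l _.
have mf : measurable_fun setT (fun y : n.-tuple R =>
    rss y (rational_sparse k) <= rss y (rational_sparse l) + eps).
  apply: measurable_fun_ler; first exact: measurable_rss.
  by apply: measurable_funD => //; exact: measurable_rss.
by have := mf measurableT [set true] I; rewrite setTI.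
Qed.

Lemma measurable_near_min_index : measurable_fun setT near_min_index.
Proof.
move=> _ Y _; rewrite setTI.
have -> : near_min_index @^-1` Y = \bigcup_(k in Y)
   ([set y | near_min y k] `&` \bigcap_(j in [set j | (j < k)%N]) ~` [set y | near_min y j]).
  apply/seteqP; split => y /=; rewrite /near_min_index; case: ex_minnP => k hk kmin.
    move=> Yk; exists k => //; split => // j /= jk; apply/negP; apply/negP => /kmin.
    by rewrite leqNgt jk.
  case=> l Yl [/= hl lmin]; suff -> : k = l by [].
  apply/eqP; rewrite eqn_leq kmin//= leqNgt; apply/negP => /lmin.
  by apply.
apply: bigcup_measurable => k _; apply: measurableI; first exact: measurable_near_min.
apply: bigcap_measurableType => j _; apply: measurableC; exact: measurable_near_min.
Qed.

Lemma least_squares_exists : exists bh : {mfun n.-tuple R >-> p.-tuple R},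
  forall y, double_sparse G s s0 (tcol (bh y)) /\
    forall b, double_sparse G s s0 b -> rss y (tcol (bh y)) <= rss y b + 2 * eps.
Proof.
pose f (y : n.-tuple R) : p.-tuple R :=
  [tuple rational_sparse (near_min_index y) i ord0 | i < p].
have mf : measurable_fun setT f.
  pose g (k : nat) : p.-tuple R := [tuple rational_sparse k i ord0 | i < p].
  have mg : measurable_fun setT g by [].
  exact: (measurableT_comp mg measurable_near_min_index).
exists (HB.pack_for {mfun n.-tuple R >-> p.-tuple R} f
  (isMeasurableFun.Build _ _ _ _ f mf)) => y /=.
have -> : tcol (f y) = rational_sparse (near_min_index y).
  by apply/matrixP => i j; rewrite [LHS]mxE tnth_mktuple (ord1 j).
split=> [|b hb]; first exact: rational_sparseP.
(* One [eps] pays for the density of the family, the other for near minimality within it. *)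
have [l hl] := rss_dense y eps0 hb.
have : near_min y (near_min_index y) by rewrite /near_min_index; case: ex_minnP.
by move/asboolP/(_ l) => h; rewrite mulr_natl mulr2n addrA (le_trans h)// lerD2r.
Qed.

End least_squares.

(** * Upper bound *)

Definition support (R : realType) (p : nat) (v : 'cV[R]_p) : {set 'I_p} :=
  [set i | v i ord0 != 0]%SET.

Section upper_bound.
Context (R : realType) (n p m d s s0 : nat) (X : 'M[R]_(n, p)).
Context (G : 'I_m -> {set 'I_p}) (sigma tau_u tau_l : R).
Hypotheses (n0 : (0 < n)%N) (s_gt0 : (0 < s)%N) (s0_gt0 : (0 < s0)%N).
Hypotheses (sm : (s <= m)%N) (s0d : (s0 <= d)%N).
Hypotheses (groupG : grouping d G) (sigma0 : 0 < sigma).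
Hypotheses (tau_u0 : 0 < tau_u) (tau_l0 : 0 < tau_l).
Hypothesis upperX : forall v : 'cV[R]_p, double_sparse G (2 * s) (2 * s0) v ->
  l2norm (X *m v) ^+ 2 <= n%:R * tau_u ^+ 2 * l2norm v ^+ 2.
Hypothesis lowerX : forall v : 'cV[R]_p, double_sparse G (2 * s) (2 * s0) v ->
  n%:R * tau_l ^+ 2 * l2norm v ^+ 2 <= l2norm (X *m v) ^+ 2.

Lemma sparse_support_double_sparse a b (v : 'cV[R]_p) (S : {set 'I_p}) :
  sparse_support G a b S -> (forall i, v i ord0 != 0 -> i \in S) ->
  double_sparse G a b v.
Proof.
move=> /andP[h1 /forallP h2] vS; apply/double_sparseE; split => [|j].
  apply: leq_trans h1; apply: subset_leq_card; apply/fintype.subsetP => j.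
  rewrite !inE => /existsP[i /andP[ij /vS iS]].
  by apply/set0Pn; exists i; rewrite inE ij.
apply: leq_trans (h2 j); apply: subset_leq_card; apply/fintype.subsetP => i.
by rewrite !inE => /andP[-> /vS].
Qed.

Lemma sparse_support_sub a b (u v : 'cV[R]_p) :
  double_sparse G a b u -> double_sparse G a b v ->
  sparse_support G (2 * a) (2 * b) (support (u - v)).
Proof.
move=> /double_sparseE[u1 u2] /double_sparseE[v1 v2].
have uv i : i \in support (u - v) -> (u i ord0 != 0) || (v i ord0 != 0).
  rewrite inE !mxE; apply: contraNT; rewrite negb_or !negbK => /andP[/eqP-> /eqP->].
  by rewrite subr0.
apply/andP; split.
  rewrite mul2n -addnn; apply: leq_trans (leq_add u1 v1).
  apply: leq_trans (leq_card_setU _ _).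
  apply: subset_leq_card; apply/fintype.subsetP => j.
  rewrite !inE => /set0Pn[i]; rewrite inE => /andP[ij /uv /orP[h|h]].
    by apply/orP; left; apply/existsP; exists i; rewrite ij.
  by apply/orP; right; apply/existsP; exists i; rewrite ij.
apply/forallP => j.
rewrite mul2n -addnn; apply: leq_trans (leq_add (u2 j) (v2 j)).
apply: leq_trans (leq_card_setU _ _).
apply: subset_leq_card; apply/fintype.subsetP => i.
by rewrite finset.in_setI => /andP[ij /uv uvi]; rewrite !inE ij.
Qed.

Lemma card_sparse_support_le a b (S : {set 'I_p}) :
  sparse_support G a b S -> (#|S| <= a * b)%N.
Proof.
have [Gcov _ _] := groupG.
move=> /andP[h1 /forallP h2].
set A := [set j | _]%SET in h1.
have : S \subset (\bigcup_(j in A) (G j :&: S))%SET.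
  apply/fintype.subsetP => i iS.
  have /bigcupP[j _ ij] : i \in (\bigcup_(j < m) G j)%SET by rewrite Gcov inE.
  apply/bigcupP; exists j; last by rewrite inE ij.
  by rewrite inE; apply/set0Pn; exists i; rewrite inE ij.
move=> /subset_leq_card h; apply: (leq_trans h).
apply: (@leq_trans (\sum_(j in A) b)%N); last by rewrite sum_nat_const leq_mul2r h1 orbT.
apply: (big_ind2 (fun (U : {set 'I_p}) k => #|U| <= k)%N) => [|U k U' k' hU hU'|j _].
- by rewrite cards0.
- exact: leq_trans (leq_card_setU _ _) (leq_add hU hU').
- exact: h2.
Qed.

(** The first bound absorbs additive constants into the rate, the second the moment factor with
    exponent [4 s s0]. *)
Lemma entropy_ge : 1 <= entropy R m d s s0 /\ s%:R * s0%:R <= entropy R m d s s0.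
Proof.
have sR : 1 <= s%:R :> R by rewrite ler1n.
have s0R : 1 <= s0%:R :> R by rewrite ler1n.
have lnge (a b : nat) : (0 < b)%N -> (b <= a)%N -> 1 <= ln (expR 1 * a%:R / b%:R) :> R.
  move=> b0 ab; rewrite -[leLHS]expRK ler_ln ?posrE ?expR_gt0//.
    by rewrite ler_pdivlMr ?ltr0n// ler_pM2l ?expR_gt0// ler_nat.
  by rewrite divr_gt0 ?mulr_gt0 ?expR_gt0 ?ltr0n// (leq_trans b0).
have l1 := lnge _ _ s_gt0 sm; have l2 := lnge _ _ s0_gt0 s0d.
rewrite /entropy; set x := ln _ in l1 *; set y := ln _ in l2 *.
have h1 : 1 <= s%:R * x by nra.
have h2 : 1 <= s%:R * s0%:R :> R by nra.
have h3 : s%:R * s0%:R <= s%:R * s0%:R * y by rewrite ler_peMr//; lra.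
by split; lra.
Qed.

Lemma least_squares_error (b bh : 'cV[R]_p) (e : n.-tuple R) (eps : R) :
  double_sparse G s s0 b -> double_sparse G s s0 bh ->
  rss X (response X b e) bh <= rss X (response X b e) b + eps ->
  l2norm (bh - b) ^+ 2 <= 4 / (n%:R * tau_l ^+ 2) ^+ 2 *
     \sum_(i in support (bh - b)) (\sum_r X r i * tnth e r) ^+ 2 +
    2 * eps / (n%:R * tau_l ^+ 2).
Proof.
move=> hb hbh hr.
set D := bh - b; set k := n%:R * tau_l ^+ 2.
have k0 : 0 < k by rewrite mulr_gt0 ?ltr0n// exprn_gt0.
pose z i := \sum_r X r i * tnth e r.
have supD : sparse_support G (2 * s) (2 * s0) (support D) by exact: sparse_support_sub.
have hD : double_sparse G (2 * s) (2 * s0) D.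
  by apply: (sparse_support_double_sparse supD) => i; rewrite inE.
(* Basic inequality of least squares, by expanding both residuals around the noise. *)
have h1 : l2norm (X *m D) ^+ 2 <= 2 * (\sum_i D i ord0 * z i) + eps.
  have -> : \sum_i D i ord0 * z i = \sum_r (X *m D) r ord0 * tnth e r.
    under [RHS]eq_bigr do rewrite mxE mulr_suml.
    rewrite [RHS]exchange_big/=; apply: eq_bigr => i _.
    by rewrite mulr_sumr; apply: eq_bigr => r _; ring.
  have e1 : rss X (response X b e) b = \sum_r tnth e r ^+ 2.
    rewrite rssE; apply: eq_bigr => r _; rewrite tnth_mktuple; congr (_ ^+ 2); ring.
  have e2 : rss X (response X b e) bh = \sum_r (tnth e r - (X *m D) r ord0) ^+ 2.
    rewrite rssE; apply: eq_bigr => r _; rewrite tnth_mktuple; congr (_ ^+ 2).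
    rewrite /D mulmxBr [in RHS]mxE [X in _ - (_ + X)]mxE; ring.
  move: hr; rewrite e1 e2 l2norm_sqr.
  have -> : \sum_r (tnth e r - (X *m D) r ord0) ^+ 2 = \sum_r tnth e r ^+ 2 +
     (\sum_r (X *m D) r ord0 ^+ 2 - 2 * \sum_r (X *m D) r ord0 * tnth e r).
    rewrite mulr_sumr -sumrB -big_split/=; apply: eq_bigr => r _; ring.
  lra.
(* Young's inequality on the support of [D], weighted so that half of the curvature [k |D|^2]
   survives. *)
have h2 : 2 * (\sum_i D i ord0 * z i) <=
    k / 2 * l2norm D ^+ 2 + 2 / k * \sum_(i in support D) z i ^+ 2.
  rewrite l2norm_sqr !mulr_sumr [X in _ <= _ + X]big_mkcond -big_split/=.
  apply: ler_sum => i _; rewrite inE; case: eqVneq => [->|_] /=.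
    by rewrite mul0r mulr0 expr0n mulr0 addr0.
  rewrite -subr_ge0.
  have -> : k / 2 * D i ord0 ^+ 2 + 2 / k * z i ^+ 2 - 2 * (D i ord0 * z i) =
    (k * D i ord0 - 2 * z i) ^+ 2 / (2 * k) by field; rewrite gt_eqF.
  by rewrite divr_ge0 ?sqr_ge0// mulr_ge0// ltW.
have h3 := lowerX hD; rewrite -/k in h3.
have h4 : k / 2 * l2norm D ^+ 2 <= 2 / k * \sum_(i in support D) z i ^+ 2 + eps by lra.
have -> : 4 / k ^+ 2 * \sum_(i in support D) z i ^+ 2 + 2 * eps / k =
  2 / k * (2 / k * \sum_(i in support D) z i ^+ 2 + eps) by field; rewrite gt_eqF.
apply: le_trans (_ : 2 / k * (k / 2 * l2norm D ^+ 2) <= _); last first.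
  by rewrite ler_wpM2l// divr_ge0// ltW.
by rewrite le_eqVlt; apply/orP; left; apply/eqP; field; rewrite gt_eqF.
Qed.

(** This is [c^2 / 2] at the largest [c] with [c^2 sigma^2 V <= 1/2], where [V = n tau_u^2]. *)
Let lam := (4 * (sigma ^+ 2 * (n%:R * tau_u ^+ 2)))^-1.
(** Bounds the logarithm of the number of supports plus that of the moment of each one. *)
Let L := 4 * entropy R m d s s0 * (1 + ln (moment_const R)).

Lemma moment_const_ge1 : 1 <= moment_const R.
Proof.
rewrite /moment_const.
have h1 : 1 <= expR 2^-1 :> R by rewrite -expR0 ler_expR.
have h2 : 1 <= (1 - expR (- 4^-1))^-1 :> R.
  rewrite invf_ge1; first by rewrite gerBl expR_ge0.
  by rewrite subr_gt0 expR_lt1 oppr_lt0 invr_gt0.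
nra.
Qed.

(** A union bound over supports in exponential form: [e^(- L)] offsets both their number and the
    moment from [score_moment]. *)
Lemma sum_score_moment (dd : measure_display) (T : measurableType dd)
    (P : probability T R) (xi : {RV P >-> n.-tuple R}) : sub_gaussian xi sigma ->
  (\int[P]_w (\sum_(S | sparse_support G (2 * s) (2 * s0) S)
      expR (lam * \sum_(i in S) score X xi i w ^+ 2 - L))%:E <= 1%:E)%E.
Proof.
move=> hxi; set V := n%:R * tau_u ^+ 2.
have V0 : 0 < V by rewrite mulr_gt0 ?ltr0n// exprn_gt0.
have sV0 : 0 < sigma ^+ 2 * V by rewrite mulr_gt0// exprn_gt0.
pose c := Num.sqrt (2 * lam).
have lam0 : 0 <= lam by rewrite invr_ge0 mulr_ge0// ltW.
have c2 : c ^+ 2 = 2 * lam by rewrite sqr_sqrtr// mulr_ge0.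
have cV : c ^+ 2 * (sigma ^+ 2 * V) <= 2^-1.
  rewrite c2 /lam -/V le_eqVlt; apply/orP; left; apply/eqP; field.
  by rewrite !gt_eqF.
have c2lam : c ^+ 2 / 2 = lam by rewrite c2; field.
have mscore (S : {set 'I_p}) : measurable_fun setT
    (fun w => expR (lam * \sum_(i in S) score X xi i w ^+ 2)).
  apply: measurableT_comp => //; apply: measurable_funM => //.
  under eq_fun do rewrite -big_filter.
  apply: measurable_sum => i; apply: measurable_funX; exact: measurable_score.
under eq_integral => w _ do rewrite -sumEFin.
have -> : (\int[P]_w \sum_(S | sparse_support G (2 * s) (2 * s0) S)
    (expR (lam * \sum_(i in S) score X xi i w ^+ 2 - L))%:E =
  \sum_(S | sparse_support G (2 * s) (2 * s0) S)
   ((expR (- L))%:E * \int[P]_w (expR (lam * \sum_(i in S) score X xi i w ^+ 2))%:E))%E.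
  under eq_integral do rewrite -big_filter.
  rewrite -[RHS]big_filter ge0_integral_sum//.
  - apply: eq_bigr => S _; rewrite -ge0_integralZl//.
    + by apply: eq_integral => w _; rewrite -EFinM -expRD addrC.
    + exact/measurable_EFinP/mscore.
  - move=> S; apply/measurable_EFinP.
    under eq_fun do rewrite expRD; apply: measurable_funM => //; exact: mscore.
apply: (@le_trans _ _ (\sum_(S | sparse_support G (2 * s) (2 * s0) S)
   (expR (- L) * moment_const R ^+ (4 * s * s0))%:E)%E).
  apply: lee_sum => S hS; rewrite EFinM; apply: lee_wpmul2l; first by rewrite lee_fin expR_ge0.
  rewrite -c2lam; apply: le_trans (score_moment hxi cV (S := S) _) _.
    by move=> v hv; apply: upperX; exact: sparse_support_double_sparse hS hv.
  rewrite lee_fin; apply: ler_weXn2l; first exact: moment_const_ge1.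
  by apply: leq_trans (card_sparse_support_le hS) _; lia.
rewrite sumEFin lee_fin.
rewrite (_ : \sum_(S | sparse_support G (2 * s) (2 * s0) S) _ =
  #|[pred S | sparse_support G (2 * s) (2 * s0) S]|%:R *
   (expR (- L) * moment_const R ^+ (4 * s * s0))); last first.
  by rewrite sumr_const -[LHS]mulr_natl.
have hc := @card_sparse_support_entropy R p m d s s0 G groupG s_gt0 s0_gt0 sm s0d.
have [ent1 ent2] := entropy_ge.
have lm0 : 0 <= ln (moment_const R) by apply: ln_ge0; exact: moment_const_ge1.
have hm : moment_const R ^+ (4 * s * s0) <=
    expR (4 * entropy R m d s s0 * ln (moment_const R)).
  rewrite -[X in X ^+ _]lnK; last first.
    by rewrite posrE; apply: lt_le_trans moment_const_ge1.
  rewrite -expRM_natl ler_expR ler_wpM2r// !natrM -mulrA ler_wpM2l//.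
apply: (@le_trans _ _ (expR (4 * entropy R m d s s0) *
   (expR (- L) * expR (4 * entropy R m d s s0 * ln (moment_const R))))).
  apply: ler_pM => //; first by rewrite mulr_ge0 ?expR_ge0// exprn_ge0// moment_const_ge0.
  by rewrite ler_wpM2l ?expR_ge0.
rewrite -!expRD expR_le1 /L; lra.
Qed.

(** The first term is the score coefficient times the bound [L + 1 <= (5 + 4 ln K) entropy], with
    [K] the moment constant; the second is the price of near minimization. *)
Definition upper_const (u l : R) : R :=
  16 * u ^+ 2 / l ^+ 4 * (5 + 4 * ln (moment_const R)) + 2 / l ^+ 2.

Lemma risk_le (bh : {mfun n.-tuple R >-> p.-tuple R}) (b : 'cV[R]_p)
    (dd : measure_display) (T : measurableType dd) (P : probability T R)
    (xi : {RV P >-> n.-tuple R}) :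
  (forall y, double_sparse G s s0 (tcol (bh y)) /\
    forall b', double_sparse G s s0 b' -> rss X y (tcol (bh y)) <= rss X y b' + sigma ^+ 2) ->
  double_sparse G s s0 b -> sub_gaussian xi sigma ->
  (risk X xi bh b <= (upper_const tau_u tau_l * minimax_rate n m d s s0 sigma)%:E)%E.
Proof.
move=> hbh hb hxi.
have nR : 0 < n%:R :> R by rewrite ltr0n.
have [ent1 ent2] := entropy_ge.
set ent := entropy R m d s s0 in ent1 ent2.
have k0 : 0 < n%:R * tau_l ^+ 2 by rewrite mulr_gt0// exprn_gt0.
have V0 : 0 < sigma ^+ 2 * (n%:R * tau_u ^+ 2) by rewrite !mulr_gt0// exprn_gt0.
have lam0 : 0 < lam by rewrite invr_gt0 mulr_gt0.
pose A := 4 / (n%:R * tau_l ^+ 2) ^+ 2 / lam.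
pose B := 2 * sigma ^+ 2 / (n%:R * tau_l ^+ 2).
have A0 : 0 <= A by rewrite !divr_ge0// ?sqr_ge0// ltW.
have B0 : 0 <= B by rewrite divr_ge0 ?mulr_ge0 ?sqr_ge0// ltW.
have lm0 : 0 <= ln (moment_const R) by apply: ln_ge0; exact: moment_const_ge1.
have L0 : 0 <= L by rewrite /L -/ent mulr_ge0// ?addr_ge0// mulr_ge0//; lra.
pose W w := \sum_(S | sparse_support G (2 * s) (2 * s0) S)
      expR (lam * \sum_(i in S) score X xi i w ^+ 2 - L).
have W0 w : 0 <= W w by apply: sumr_ge0 => S _; exact: expR_ge0.
have mW : measurable_fun setT W.
  rewrite /W; under eq_fun do rewrite -big_filter.
  apply: measurable_sum => S; apply: measurableT_comp => //.
  apply: measurable_funB => //; apply: measurable_funM => //.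
  under eq_fun do rewrite -big_filter.
  apply: measurable_sum => i; apply: measurable_funX; exact: measurable_score.
have mresp : measurable_fun setT (fun w => response X b (xi w)).
  apply/measurable_fun_tnthP => i.
  rewrite (_ : _ \o _ = fun w => (X *m b) i ord0 + tnth (xi w) i).
    by apply: measurable_funD => //; exact: measurable_noise.
  by apply/funext => w; rewrite /= tnth_mktuple.
have mloss : measurable_fun setT
    (fun w => l2norm (tcol (bh (response X b (xi w))) - b) ^+ 2).
  under eq_fun do rewrite l2norm_sub_sqr.
  apply: measurable_sum => i; apply: measurable_funX; apply: measurable_funB => //.
  under eq_fun do rewrite mxE.
  apply: (measurableT_comp (measurable_tnth i)).
  exact: (measurableT_comp (measurable_funPT bh) mresp).
have hloss w : l2norm (tcol (bh (response X b (xi w))) - b) ^+ 2 <= (A * L + B) + A * W w.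
  have [h1 h2] := hbh (response X b (xi w)).
  apply: (le_trans (least_squares_error hb h1 (h2 _ hb))).
  set S := support _; rewrite -/B.
  suff : lam * \sum_(i in S) score X xi i w ^+ 2 <= L + W w.
    move=> /(ler_wpM2l A0); rewrite {1}/A mulrA divfK ?gt_eqF// mulrDr /score; lra.
  have hS : sparse_support G (2 * s) (2 * s0) S by exact: sparse_support_sub.
  (* From [x - L <= e^(x - L)]; the sum over all supports then covers the random support [S]. *)
  apply: (@le_trans _ _ (L + expR (lam * \sum_(i in S) score X xi i w ^+ 2 - L))).
    have := expR_ge1Dx (lam * \sum_(i in S) score X xi i w ^+ 2 - L); lra.
  rewrite lerD2l /W (bigD1 S)//= lerDl.
  by apply: sumr_ge0 => S' _; exact: expR_ge0.
rewrite /risk expectation.unlock.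
apply: (@le_trans _ _ (\int[P]_w ((A * L + B)%:E + A%:E * (W w)%:E))%E).
  apply: ge0_le_integral => //.
  - by move=> w _; rewrite lee_fin sqr_ge0.
  - exact/measurable_EFinP.
  - apply: emeasurable_funD => //; apply: emeasurable_funM => //.
    exact/measurable_EFinP.
  - by move=> w _; rewrite -EFinM -EFinD lee_fin.
rewrite ge0_integralD//; last 3 first.
- by move=> w _; rewrite lee_fin; apply: addr_ge0 => //; exact: mulr_ge0.
- by move=> w _; rewrite -EFinM lee_fin; exact: mulr_ge0.
- by apply: emeasurable_funM => //; exact/measurable_EFinP.
rewrite integral_cst// [X in (_ * X + _)%E](_ : _ = 1%E); last exact: probability_setT.
rewrite mule1 ge0_integralZl//; last 2 first.
- exact/measurable_EFinP.
- by move=> w _; rewrite lee_fin.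
apply: (@le_trans _ _ ((A * L + B)%:E + A%:E * 1%:E)%E).
  rewrite leeD2l//; apply: lee_wpmul2l; first by rewrite lee_fin.
  exact: sum_score_moment.
rewrite -EFinM -EFinD lee_fin mulr1.
have -> : minimax_rate n m d s s0 sigma = sigma ^+ 2 / n%:R * ent by [].
have AE : A = 16 * tau_u ^+ 2 / tau_l ^+ 4 * (sigma ^+ 2 / n%:R).
  by rewrite /A /lam invrK; field; rewrite !gt_eqF.
have BE : B = 2 / tau_l ^+ 2 * (sigma ^+ 2 / n%:R).
  by rewrite /B; field; rewrite !gt_eqF.
have hL : L + 1 <= (5 + 4 * ln (moment_const R)) * ent by rewrite /L -/ent; nra.
have hB : B <= B * ent by rewrite ler_peMr.
have hA := ler_wpM2l A0 hL.
rewrite /upper_const [leRHS](_ : _ = A * ((5 + 4 * ln (moment_const R)) * ent) + B * ent).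
  lra.
by rewrite AE BE; ring.
Qed.

Lemma minimax_risk_le :
  (minimax_risk X G s s0 sigma <=
    (upper_const tau_u tau_l * minimax_rate n m d s s0 sigma)%:E)%E.
Proof.
(* The slack is lost twice, making [sigma^2] in the residual and a multiple of [sigma^2 / n] in the
   risk. *)
have eps0 : 0 < sigma ^+ 2 / 2 by rewrite divr_gt0// exprn_gt0.
have [bh hbh] := least_squares_exists X G s s0 eps0.
apply: (@le_trans _ _ (worst_case_risk X G s s0 sigma bh)).
  by apply: ereal_inf_lbound; exists bh.
apply: ge_ereal_sup => r [b [dd [T [P [xi [hb hxi ->]]]]]].
apply: risk_le => // y; have [h1 h2] := hbh y; split => // b' hb'.
by rewrite -[sigma ^+ 2](@divfK _ 2)// mulrC h2.
Qed.

End upper_bound.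

(** * Assembly of the two bounds *)

Lemma upper_const_gt0 (R : realType) (u l : R) : 0 < u -> 0 < l -> 0 < upper_const u l.
Proof.
move=> u0 l0.
have lm0 : 0 <= ln (moment_const R) by apply: ln_ge0; exact: moment_const_ge1.
have h1 : 0 <= 16 * u ^+ 2 / l ^+ 4 * (5 + 4 * ln (moment_const R)).
  apply: mulr_ge0; last by lra.
  by apply: divr_ge0; [apply: mulr_ge0 => //; exact: sqr_ge0|apply: exprn_ge0; exact: ltW].
have h2 : 0 < 2 / l ^+ 2 by apply: divr_gt0 => //; exact: exprn_gt0.
rewrite /upper_const; lra.
Qed.

(** A column is the image of a basis vector, which is double sparse at all positive levels because
    disjoint groups share no index. This supplies [V] in the lower bound. *)
Lemma column_norm_le (R : realType) (n p m a b : nat) (X : 'M[R]_(n, p))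
    (G : 'I_m -> {set 'I_p}) (V : R) (i : 'I_p) :
  (forall j k : 'I_m, j != k -> [disjoint G j & G k]%B) ->
  (0 < a)%N -> (0 < b)%N ->
  (forall v : 'cV[R]_p, double_sparse G a b v ->
    l2norm (X *m v) ^+ 2 <= V * l2norm v ^+ 2) ->
  \sum_r X r i ^+ 2 <= V.
Proof.
move=> Gdis a0 b0 hV.
have dE (j : 'I_p) : (delta_mx i ord0 : 'cV[R]_p) j ord0 = (j == i)%:R by rewrite mxE andbT.
have := hV (delta_mx i ord0).
have -> : l2norm (delta_mx i ord0 : 'cV[R]_p) ^+ 2 = 1.
  rewrite l2norm_sqr (bigD1 i)//= dE eqxx expr1n big1 ?addr0// => j /negPf ji.
  by rewrite dE ji expr0n.
have -> : l2norm (X *m delta_mx i ord0) ^+ 2 = \sum_r X r i ^+ 2.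
  by rewrite l2norm_sqr -colE; apply: eq_bigr => r _; rewrite mxE.
rewrite mulr1; apply; apply/double_sparseE; split => [|j].
  apply: leq_trans a0; rewrite leqNgt; apply/negP => /card_gt1P[j [k [+ + jk]]].
  rewrite !inE => /existsP[x /andP[xj]]; rewrite dE pnatr_eq0 eqb0 negbK => /eqP xi.
  move=> /existsP[y /andP[yk]]; rewrite dE pnatr_eq0 eqb0 negbK => /eqP yi.
  have /disjoint_setI0/setP/(_ i) := Gdis j k jk.
  by rewrite !inE -{1}xi xj -yi yk.
apply: leq_trans (_ : #|[set i]%SET| <= _)%N; last by rewrite cards1.
apply: subset_leq_card; apply/fintype.subsetP => x.
by rewrite !inE dE pnatr_eq0 eqb0 negbK => /andP[].
Qed.

Theorem corollary1 (R : realType) (tau_u tau_l c1 c2 : R)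
    (tau_u_gt0 : 0 < tau_u) (tau_l_gt0 : 0 < tau_l)
    (c1_gt0 : 0 < c1) (c2_gt0 : 0 < c2) :
  exists c C : R, [/\ 0 < c, 0 < C &
    forall (n p m d s s0 : nat) (G : 'I_m -> {set 'I_p}) (X : 'M[R]_(n, p))
      (sigma : R),
      (0 < n)%N -> (0 < s)%N -> (0 < s0)%N -> p = (m * d)%N ->
      grouping d G ->
      0 < sigma ->
      (4 * s <= m)%N -> c1 <= (4 * s)%:R ->
      (4 * s0 <= d)%N -> c2 <= (4 * s0)%:R ->
      (forall beta : 'cV[R]_p, double_sparse G (2 * s) (2 * s0) beta ->
        (Num.sqrt n%:R)^-1 * l2norm (X *m beta) <= tau_u * l2norm beta) ->
      (forall beta : 'cV[R]_p, double_sparse G (2 * s) (2 * s0) beta ->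
        tau_l * l2norm beta <= (Num.sqrt n%:R)^-1 * l2norm (X *m beta)) ->
      ((c * minimax_rate n m d s s0 sigma)%:E
         <= minimax_risk X G s s0 sigma)%E /\
      (minimax_risk X G s s0 sigma
         <= (C * minimax_rate n m d s s0 sigma)%:E)%E].
Proof.
exists (7 / 48 / (320 * tau_u ^+ 2)), (upper_const tau_u tau_l); split.
- by apply: divr_gt0; [lra|apply: mulr_gt0 => //; exact: exprn_gt0].
- exact: upper_const_gt0.
move=> n p m d s s0 G X sigma n0 s_gt0 s0_gt0 _ groupG sigma0 sm _ s0d _ hu hl.
have nR : 0 < n%:R :> R by rewrite ltr0n.
have sq0 : 0 < Num.sqrt n%:R :> R by rewrite sqrtr_gt0.
have sqE : Num.sqrt n%:R ^+ 2 = n%:R :> R by rewrite sqr_sqrtr// ltW.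
have hu2 (v : 'cV[R]_p) : double_sparse G (2 * s) (2 * s0) v ->
    l2norm (X *m v) ^+ 2 <= n%:R * tau_u ^+ 2 * l2norm v ^+ 2.
  move=> /hu; rewrite mulrC ler_pdivrMr// => h.
  have -> : n%:R * tau_u ^+ 2 * l2norm v ^+ 2 = (tau_u * l2norm v * Num.sqrt n%:R) ^+ 2.
    by rewrite !exprMn sqE; ring.
  by rewrite lerXn2r ?nnegrE ?sqrtr_ge0// !mulr_ge0 ?sqrtr_ge0// ltW.
have hl2 (v : 'cV[R]_p) : double_sparse G (2 * s) (2 * s0) v ->
    n%:R * tau_l ^+ 2 * l2norm v ^+ 2 <= l2norm (X *m v) ^+ 2.
  move=> /hl; rewrite [leRHS]mulrC ler_pdivlMr// => h.
  have -> : n%:R * tau_l ^+ 2 * l2norm v ^+ 2 = (tau_l * l2norm v * Num.sqrt n%:R) ^+ 2.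
    by rewrite !exprMn sqE; ring.
  by rewrite lerXn2r ?nnegrE ?sqrtr_ge0// !mulr_ge0 ?sqrtr_ge0// ltW.
split; last first.
  by apply: minimax_risk_le => //; lia.
apply: le_ereal_inf_tmp => r [bh ->].
apply: worst_case_risk_ge_rate => // i.
have [_ Gdis _] := groupG.
by apply: (column_norm_le i Gdis _ _ hu2); rewrite muln_gt0.
Qed.
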